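(* Let $K,L\subset\mathbb{R}^n$ be convex bodies, and let $R$ be the radius of a ball containing $K_2$ and $L_2$. Then $$ d_{bL}(\Lambda_i(K,\cdot), \Lambda_i(L,\cdot)) \le C(R)\, d_H(K,L)^{1/2}$$ for $i\in\{0,\dots,n-1\}$, where $C(R)$ is a constant which (for given dimension $n$) depends only on $R$.
   Context: A convex body is a nonempty compact convex subset of $\mathbb{R}^n$; $d_H$ is the Hausdorff metric. $B^n$, $\mathbb{S}^{n-1}$ are the closed unit ball and the unit sphere of $\mathbb{R}^n$, $K_\rho:=K+\rho B^n$ for $\rho>0$, $\mathcal{H}^n$ is $n$-dimensional Hausdorff measure, and $\kappa_j$ is the volume of the unit ball in $\mathbb{R}^j$. Put $\Sigma:=\mathbb{R}^n\times\mathbb{S}^{n-1}\subset\mathbb{R}^{2n}$, with the Euclidean norm $|\cdot|$ of $\mathbb{R}^{2n}$. For a convex body $K$, $p_K$ is the metric projection (nearest point map) onto $K$, $d_K(x):=|x-p_K(x)|$ and $u_K(x):=(x-p_K(x))/d_K(x)$ for $x\in\mathbb{R}^n\setminus K$. For $\rho>0$ let $K^\rho:=K_\rho\setminus K$ and let $\mu_{K,\rho}$ be the image measure of $\mathcal{H}^n\llcorner K^\rho$ under the map $K^\rho\to\Sigma$, $x\mapsto(p_K(x),u_K(x))$; it is a finite Borel measure on $\Sigma$. The support measures $\Lambda_0(K,\cdot),\dots,\Lambda_{n-1}(K,\cdot)$ of $K$ are the finite Borel measures on $\Sigma$ (uniquely) determined by $$\mu_{K,\rho}=\sum_{i=0}^{n-1}\rho^{n-i}\kappa_{n-i}\Lambda_i(K,\cdot)\qquad\text{for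 all }\rho>0.$$ For bounded $f:\Sigma\to\mathbb{R}$ let $\|f\|_L:=\sup_{x\ne y}|f(x)-f(y)|/|x-y|$ and $\|f\|_\infty:=\sup_x|f(x)|$. For finite Borel measures $\mu,\nu$ on $\Sigma$, the bounded Lipschitz distance is $$d_{bL}(\mu,\nu):=\sup\left\{\left|\int_\Sigma f\,d\mu-\int_\Sigma f\,d\nu\right|: f:\Sigma\to\mathbb{R},\ \|f\|_L\le1,\ \|f\|_\infty\le1\right\}.$$ *)

(* Defs.v *)
From HB Require Import structures.
From mathcomp Require Import all_boot all_order all_algebra.
From mathcomp Require Import all_classical all_reals all_analysis.
Set Implicit Arguments.
Unset Strict Implicit.
Unset Printing Implicit Defensive.
Import Order.TTheory GRing.Theory Num.Theory.
Import numFieldNormedType.Exports.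
Local Open Scope classical_set_scope.
Local Open Scope ring_scope.

(* R^n is 'rV[R]_n. The norm that MathComp-Analysis puts on it is the sup norm;
   it induces the Euclidean topology, so the library's compact and open are used
   as they are, but every metric notion goes through enorm. *)

Section euclidean.
Variables (R : realType) (n : nat).
Local Notation E := 'rV[R]_n.
Implicit Types (x c : E) (K L : set E).

Definition enorm x : R := Num.sqrt (\sum_i x 0 i ^+ 2).

Definition eball c (r : R) : set E := [set x | enorm (x - c) <= r].

Definition convex_body K : Prop := [/\ K !=set0, compact K & convex_set K].

(* K_rho = K + rho B^n *)
Definition parallel_body K (rho : R) : set E :=
  [set y + rho *: b | y in K & b in eball 0 1].

Definition hausdorff_distance K L : R :=
  Num.max (sup [set inf [set enorm (x - y) | y in L] | x in K])
          (sup [set inf [set enorm (x - y) | x in K] | y in L]).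

(* The nearest point of K to x (0 if there is none, which does not happen when
   K is a convex body). *)
Definition proj K x : E :=
  xget 0 [set p | K p /\ forall q, K q -> enorm (x - p) <= enorm (x - q)].

Definition dist_to K x : R := enorm (x - proj K x).

Definition normal_dir K x : E := (dist_to K x)^-1 *: (x - proj K x).

(* K^rho = K_rho \ K *)
Definition parallel_shell K (rho : R) : set E := parallel_body K rho `\` K.

(* 0 for the empty set *)
Definition diameter (A : set E) : \bar R :=
  maxe 0%E (ereal_sup [set (enorm (p.1 - p.2))%:E | p in A `*` A]).

End euclidean.

(* n-dimensional volume of Borel sets: the n-fold product of lebesgue_measure,
   where the product of two measures is written out as the integral of the
   measure of the sections. *)
Fixpoint volume (R : realType) (n : nat) : set 'rV[R]_n -> \bar R :=
  match n with
  | 0 => fun A => (\1_A (0 : 'rV[R]_0))%:E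
  | m.+1 => fun A =>
      (\int[lebesgue_measure]_(t in [set: R])
         volume [set y : 'rV[R]_m | A (row_mx (t%:M : 'M[R]_1) y)])%E
  end.

Definition kappa (R : realType) (j : nat) : R :=
  fine (volume (eball (0 : 'rV[R]_j) 1)).

Section support_measures.
Variables (R : realType) (n' : nat).
Local Notation n := n'.+1.
Local Notation E := 'rV[R]_n.
Implicit Types (K : set E).

(* n-dimensional Hausdorff measure, normalized so that a set of diameter d
   contributes the volume of a ball of diameter d; the limit for delta -> 0 is a
   supremum because hausdorff_pre is nonincreasing in delta. *)
Definition hausdorff_pre (delta : R) (A : set E) : \bar R :=
  ereal_inf [set (\sum_(0 <= k <oo)
                    ((kappa R n / 2 ^+ n)%:E * diameter (C k) ^+ n))%E
            | C in [set C : (set E)^nat |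
                     A `<=` \bigcup_k C k /\
                     forall k, (diameter (C k) <= delta%:E)%E]].

Definition hausdorff_measure (A : set E) : \bar R :=
  ereal_sup [set hausdorff_pre delta A | delta in [set delta | 0 < delta]].

(* Sigma = R^n x S^{n-1} with the subspace topology of R^n x R^n; the dimension
   is a successor because a measurableType must be inhabited. *)
Definition Sigma_set : set (E * E) := [set p | enorm p.2 = 1].

Definition Sigma : Type := Sigma_set.
HB.instance Definition _ := Topological.copy Sigma (set_type Sigma_set).

Lemma Sigma_point_subproof : (0, delta_mx 0 0) \in Sigma_set.
Proof.
rewrite inE /Sigma_set /enorm /= (bigD1 ord0) //= big1 => [|j /negPf j0].
  by rewrite !mxE !eqxx expr1n addr0 sqrtr1.
by rewrite !mxE j0 andbF expr0n.
Qed.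
HB.instance Definition _ := isPointed.Build Sigma
  (exist _ (0, delta_mx 0 0) Sigma_point_subproof : Sigma).

Definition Sigma_borel := g_sigma_algebraType (@open Sigma).
HB.instance Definition _ := Measurable.on Sigma_borel.

Implicit Types (s t : Sigma) (f : Sigma -> R).

Definition Sigma_val s : E * E := set_val (s : Sigma_set).

(* distance for the Euclidean norm of R^{2n} *)
Definition Sigma_dist s t : R :=
  Num.sqrt (enorm ((Sigma_val s).1 - (Sigma_val t).1) ^+ 2 +
            enorm ((Sigma_val s).2 - (Sigma_val t).2) ^+ 2).

(* mu_{K,rho}: the image of the Hausdorff measure restricted to K^rho under
   x |-> (p_K(x), u_K(x)), which maps K^rho into Sigma when K is a convex body *)
Definition local_parallel_measure K (rho : R) (A : set Sigma_borel) : \bar R :=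
  hausdorff_measure (parallel_shell K rho `&`
    (fun x => (proj K x, normal_dir K x)) @^-1` (Sigma_val @` A)).

Definition support_measures K
    (Lambda : 'I_n -> {finite_measure set Sigma_borel -> \bar R}) : Prop :=
  forall rho : R, 0 < rho -> forall A : set Sigma_borel, measurable A ->
    local_parallel_measure K rho A =
    (\sum_(i < n) (rho ^+ (n - i) * kappa R (n - i))%:E * Lambda i A)%E.

Definition lip_norm f : \bar R :=
  ereal_sup [set (`|f p.1 - f p.2| / Sigma_dist p.1 p.2)%:E
            | p in [set p : Sigma * Sigma | p.1 <> p.2]].

Definition sup_norm f : \bar R := ereal_sup [set `|f s|%:E | s in [set: Sigma]].

Definition bL_distance
    (mu nu : {finite_measure set Sigma_borel -> \bar R}) : \bar R :=
  ereal_sup [set `|\int[mu]_(s in setT) (f s)%:E - \int[nu]_(s in setT) (f s)%:E|%E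
            | f in [set f : Sigma -> R |
                     (lip_norm f <= 1)%E /\ (sup_norm f <= 1)%E]].

End support_measures.

(* Main.v *)
(* The difference of the measures mu_{K,rho} and mu_{K,1} is the image of the
   Hausdorff measure on {1 < d_K <= rho}, where the normal direction u_K depends
   stably on K: with d = d_H(K, L), one has |d_K - d_L| <= d,
   |p_K - p_L|^2 <= (d_K + d_L) d and |u_K - u_L| <= |p_K - p_L|. A Lipschitz
   function f therefore has nearly the same integral for K and for L, up to the
   volume of {1 < d_K <= 1 + d} and {rho - d < d_K <= rho}, which is of order d
   because the volume of the parallel bodies is a polynomial in rho with bounded
   nonnegative coefficients. So the polynomial in rho with coefficients
   kappa_{n-i} (int f dLambda_i(K) - int f dLambda_i(L)) in degree n - i varies
   by O(sqrt d) on [1, 2], and its coefficients are recovered by inverting a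
   Vandermonde matrix. *)

From HB Require Import structures.
From Pilot Require Import Defs.
From mathcomp Require Import all_boot all_order all_algebra.
From mathcomp Require Import all_classical all_reals all_analysis.
From mathcomp Require Import measurable_realfun ring lra.
Set Implicit Arguments.
Unset Strict Implicit.
Unset Printing Implicit Defensive.
Import Order.TTheory GRing.Theory Num.Theory.
Import numFieldNormedType.Exports.
Local Open Scope classical_set_scope.
Local Open Scope ring_scope.

Local Notation proj := Pilot.Defs.proj.

(** * Euclidean geometry and metric projections *)

Section euclidean_space.
Context {R : realType} {n : nat}.
Local Notation E := 'rV[R]_n.
Implicit Types (x y z p q : E) (K L : set E).

(** The shells start at distance 1 because [normal_dir] divides by [dist_to]: close to the body a
    small change of K can turn the normal by a large angle, while at distance at least 1
    normalization is 1-Lipschitz. The exponent 1/2 comes from [proj_stability], which controls only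
    the square of the displacement of the nearest point; the thin layers alone would give order d.
    These layers lie between the distances 0 and 2 when d < 1; for d >= 1 a bound on the total
    masses suffices. Hausdorff measure enters as a metric outer measure with an explicit bound on
    balls, and the polynomial dependence on rho is read off from [support_measures]. Test functions
    may change sign, so f is replaced by f + 1, with values in [0, 2], and the constant 1 is treated
    separately; every integral that is compared then has a nonnegative integrand. *)

Definition dot x y : R := \sum_i x 0 i * y 0 i.

Lemma dotC x y : dot x y = dot y x.
Proof. by apply: eq_bigr => i _; rewrite mulrC. Qed.

Lemma dotDl x y z : dot (x + y) z = dot x z + dot y z.
Proof. by rewrite -big_split; apply: eq_bigr => i _; rewrite !mxE mulrDl. Qed.

Lemma dotZl a x y : dot (a *: x) y = a * dot x y.
Proof. by rewrite mulr_sumr; apply: eq_bigr => i _; rewrite !mxE mulrA. Qed.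

Lemma dotNl x y : dot (- x) y = - dot x y.
Proof. by rewrite -scaleN1r dotZl mulN1r. Qed.

Lemma dotDr x y z : dot x (y + z) = dot x y + dot x z.
Proof. by rewrite dotC dotDl !(dotC x). Qed.

Lemma dotZr a x y : dot x (a *: y) = a * dot x y.
Proof. by rewrite dotC dotZl dotC. Qed.

Lemma dotNr x y : dot x (- y) = - dot x y.
Proof. by rewrite dotC dotNl dotC. Qed.

Definition dotE := (dotDl, dotDr, dotNl, dotNr, dotZl, dotZr).

Lemma dotxx_ge0 x : 0 <= dot x x.
Proof. by apply: sumr_ge0 => i _; rewrite -expr2 sqr_ge0. Qed.

Lemma sqr_enorm x : enorm x ^+ 2 = dot x x.
Proof.
rewrite /enorm sqr_sqrtr; last by apply: sumr_ge0 => i _; exact: sqr_ge0.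
by apply: eq_bigr => i _; rewrite expr2.
Qed.

Lemma enorm_ge0 x : 0 <= enorm x.
Proof. exact: sqrtr_ge0. Qed.
Hint Extern 0 (is_true (0 <= enorm _)) => exact: enorm_ge0 : core.

Lemma ler_enorm x (a : R) : 0 <= a -> (enorm x <= a) = (dot x x <= a ^+ 2).
Proof. by move=> a0; rewrite -sqr_enorm ler_pXn2r ?nnegrE. Qed.

Lemma enorm0 : enorm (0 : E) = 0.
Proof. by rewrite /enorm big1 ?sqrtr0 // => i _; rewrite mxE expr0n. Qed.

Lemma coord_le_enorm x i : `|x 0 i| <= enorm x.
Proof.
rewrite -(ler_pXn2r (n := 2)) ?nnegrE // sqr_enorm /dot (bigD1 i) //=.
rewrite real_normK ?num_real // -expr2 lerDl.
by apply: sumr_ge0 => j _; rewrite -expr2 sqr_ge0.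
Qed.

Lemma enorm_eq0 x : (enorm x == 0) = (x == 0).
Proof.
apply/eqP/eqP => [x0|->]; last exact: enorm0.
apply/rowP => i; rewrite mxE; apply/normr0_eq0/le_anti.
by rewrite normr_ge0 andbT -x0 coord_le_enorm.
Qed.

Lemma enormZ a x : enorm (a *: x) = `|a| * enorm x.
Proof.
apply/eqP; rewrite -(eqrXn2 (n := 2)) ?mulr_ge0 // exprMn !sqr_enorm !dotE.
by rewrite real_normK ?num_real // expr2 mulrA.
Qed.

Lemma enormN x : enorm (- x) = enorm x.
Proof. by rewrite -scaleN1r enormZ normrN1 mul1r. Qed.

Lemma enormB x y : enorm (x - y) = enorm (y - x).
Proof. by rewrite -enormN opprB. Qed.

(** Cauchy-Schwarz: expand the square of |y| x - |x| y and divide by |x| |y|. *)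
Lemma dot_le x y : dot x y <= enorm x * enorm y.
Proof.
have [->|y0] := eqVneq y 0.
  by rewrite enorm0 mulr0 /dot big1 // => i _; rewrite mxE mulr0.
have yp : 0 < enorm y by rewrite lt_def enorm_eq0 y0 enorm_ge0.
have [->|x0] := eqVneq x 0.
  by rewrite enorm0 mul0r /dot big1 // => i _; rewrite mxE mul0r.
have xp : 0 < enorm x by rewrite lt_def enorm_eq0 x0 enorm_ge0.
have := dotxx_ge0 (enorm y *: x - enorm x *: y).
rewrite !dotE (dotC y x) -!sqr_enorm.
have xyp : 0 < enorm x * enorm y by rewrite mulr_gt0.
move=> h; rewrite -(ler_pM2l xyp); nra.
Qed.

Lemma enormD x y : enorm (x + y) <= enorm x + enorm y.
Proof.
rewrite ler_enorm ?addr_ge0 // !dotE -!sqr_enorm (dotC y x).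
have := dot_le x y; nra.
Qed.

Lemma enorm_triangle y x z : enorm (x - z) <= enorm (x - y) + enorm (y - z).
Proof. by rewrite -(subrKA y x) enormD. Qed.

Lemma enorm_dist x y : `|enorm x - enorm y| <= enorm (x - y).
Proof.
have := enorm_triangle y x 0; have := enorm_triangle x y 0.
rewrite !subr0 (enormB y x) ler_norml; lra.
Qed.

Lemma enorm_le_coord x (a : R) : (forall i, `|x 0 i| <= a) ->
  enorm x <= n%:R * a.
Proof.
move=> xa; have [->|x0] := eqVneq x 0.
  case: (posnP n) => [n0|n0]; first by rewrite enorm0 n0 mul0r.
  by rewrite enorm0 mulr_ge0 // (le_trans _ (xa (Ordinal n0))).
have xp : 0 < enorm x by rewrite lt_def enorm_eq0 x0 enorm_ge0.
rewrite -(ler_pM2l xp) -expr2 sqr_enorm mulrCA mulr_natl -[n in _ *+ n]card_ord.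
rewrite -sumr_const; apply: ler_sum => i _.
rewrite (le_trans (ler_norm _)) // normrM ler_pM ?normr_ge0 //.
exact: coord_le_enorm.
Qed.

(** The bridge from the sup-norm neighbourhoods of the library to Euclidean balls; the two norms
    differ at most by the factor n. *)
Lemma nbhs_enormP x (A : set E) :
  nbhs x A <-> exists2 e : R, 0 < e & forall y, enorm (x - y) < e -> A y.
Proof.
split=> [/nbhs_ballP[e /= e0 eA]|[e e0 eA]].
  exists e => // y xy; apply: eA; split=> // i j.
  rewrite ord1 -ball_normE /=; apply: le_lt_trans xy.
  by have := coord_le_enorm (x - y) j; rewrite !mxE.
(* Dividing by n + 1 rather than n gives a strict inequality and covers n = 0. *)
apply/nbhs_ballP; exists (e / n.+1%:R) => /= [|y [_ xy]]; first exact: divr_gt0.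
apply: eA; apply: (@le_lt_trans _ _ (n%:R * (e / n.+1%:R))).
  apply: enorm_le_coord => i; have := xy 0 i.
  by rewrite -ball_normE /= !mxE => /ltW.
by rewrite mulrCA gtr_pMr // ltr_pdivrMr // mul1r ltr_nat.
Qed.

Lemma enorm_lipschitz_cvg (f : E -> R) (c : R) :
  (forall x y, `|f x - f y| <= c * enorm (x - y)) -> continuous f.
Proof.
move=> fc x A /nbhs_ballP[e /= e0 eA]; apply/nbhs_enormP.
have c0 : 0 < `|c| + 1 by rewrite ltr_pwDr.
exists (e / (`|c| + 1)) => [|y]; first exact: divr_gt0.
rewrite ltr_pdivlMr // => xy; apply: eA; rewrite -ball_normE /=.
apply: le_lt_trans xy.
rewrite (le_trans (fc _ _)) // mulrC ler_wpM2l //.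
by have := ler_norm c; lra.
Qed.

Lemma enorm_lipschitz_cvgV (f : E -> E) (c : R) :
  (forall x y, enorm (f x - f y) <= c * enorm (x - y)) -> continuous f.
Proof.
move=> fc x A /nbhs_enormP[e e0 eA]; apply/nbhs_enormP.
have c0 : 0 < `|c| + 1 by rewrite ltr_pwDr.
exists (e / (`|c| + 1)) => [|y]; first exact: divr_gt0.
rewrite ltr_pdivlMr // => xy; apply: eA; apply: le_lt_trans xy.
rewrite (le_trans (fc _ _)) // mulrC ler_wpM2l //.
by have := ler_norm c; lra.
Qed.

Lemma dot_line x y (t : R) :
  dot (x - t *: y) (x - t *: y) = dot x x - 2 * t * dot x y + t ^+ 2 * dot y y.
Proof. by rewrite !dotE (dotC y x); ring. Qed.

Lemma dot_split x y p q : dot (x - y) (p - q) =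
  dot (p - q) (p - q) + (- dot (x - p) (q - p) - dot (y - q) (p - q)).
Proof. by rewrite !dotE; ring. Qed.

Lemma sqr_enorm_split x p q :
  enorm (p - q) ^+ 2 = dot (x - p) (q - p) + dot (x - q) (p - q).
Proof. by rewrite sqr_enorm !dotE (dotC q p); ring. Qed.

Lemma dist_toE K x : dist_to K x = enorm (x - proj K x).
Proof. by []. Qed.

Lemma normal_dirE K x : normal_dir K x = (dist_to K x)^-1 *: (x - proj K x).
Proof. by []. Qed.

Local Opaque enorm dot dist_to normal_dir.

Section projection.
Variable K : set E.
Hypothesis cK : convex_body K.

Lemma projP x : K (proj K x) /\ forall q, K q ->
  enorm (x - proj K x) <= enorm (x - q).
Proof.
have [K0 kK _] := cK.
have cf : continuous (fun y => enorm (x - y)).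
  apply: (@enorm_lipschitz_cvg _ 1) => y z; rewrite mul1r.
  by rewrite (le_trans (enorm_dist _ _)) // opprB addrC subrKA enormB.
have [|p pK pmin] := compact_EVT_min K0 kK _ (f := fun y => enorm (x - y)).
  exact: continuous_subspaceT.
rewrite /proj; case: xgetP => [_ _ //|/(_ p)[]]; split; first exact/set_mem.
by move=> q Kq; exact/pmin/mem_set.
Qed.

Lemma proj_in x : K (proj K x).
Proof. by case: (projP x). Qed.
Hint Resolve proj_in : core.

Lemma dist_to_le x q : K q -> dist_to K x <= enorm (x - q).
Proof. by rewrite dist_toE; case: (projP x) => _; exact. Qed.

Lemma dist_to_ge0 x : 0 <= dist_to K x.
Proof. by rewrite dist_toE. Qed.

(* The derivative at 0 of [t |-> |x - p - t (q - p)|^2] on [[0, 1]] is >= 0. *)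
Lemma proj_dot x q : K q -> dot (x - proj K x) (q - proj K x) <= 0.
Proof.
move=> Kq; have [_ _ cvK] := cK; set p := proj K x.
pose w : E := x - p; pose v : E := q - p.
rewrite -[x - p]/w -[q - p]/v.
have key (t : R) : 0 <= t -> t <= 1 -> 2 * t * dot w v <= t ^+ 2 * dot v v.
  move=> t0 t1.
  have /set_mem := cvK q p (Itv01 t0 t1) (mem_set Kq) (mem_set (proj_in x)).
  rewrite /conv /= => Kt; have := dist_to_le x Kt.
  rewrite (_ : x - _ = w - t *: v); last first.
    rewrite /w /v; apply/rowP => i; rewrite !mxE /= /unstable.onem; ring.
  rewrite dist_toE -/p -/w ler_enorm ?enorm_ge0 // sqr_enorm dot_line.
  by lra.
have [//|wv] := leP (dot w v) 0.
have vv : 0 <= dot v v := dotxx_ge0 v.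
(* At t = 1, [key] gives 2 w.v <= v.v, so v.v > 0 and the minimizer t = w.v / v.v lies in [0, 1]. At
   that t, [key] reads 2 t w.v <= t w.v, a contradiction. *)
have := key 1 ler01 (lexx _); rewrite expr1n !mulr1 !mul1r => h1.
have vp : 0 < dot v v by nra.
pose t := dot w v / dot v v.
have tE : t * dot v v = dot w v by rewrite mulfVK ?gt_eqF.
have t0 : 0 < t by rewrite divr_gt0.
have t1 : t <= 1 by rewrite ler_pdivrMr //; lra.
have := key t (ltW t0) t1; rewrite expr2 -[t * t * _]mulrA tE.
by have := mulr_gt0 t0 wv; lra.
Qed.

(** Adding [proj_dot] at x and at y gives |p - q|^2 <= (x - y).(p - q); Cauchy-Schwarz finishes. *)
Lemma proj_nonexpansive x y : enorm (proj K x - proj K y) <= enorm (x - y).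
Proof.
have := proj_dot x (proj_in y); have := proj_dot y (proj_in x).
set p := proj K x; set q := proj K y => hy hx.
have : dot (p - q) (p - q) <= dot (x - y) (p - q).
  rewrite (dot_split x y) lerDl.
  by apply: addr_ge0; rewrite oppr_ge0; [exact: hx|exact: hy].
have := dot_le (x - y) (p - q); rewrite -sqr_enorm => h1 h2.
have := enorm_ge0 (p - q); rewrite le_eqVlt => /predU1P[<-//|e0].
by rewrite -(ler_pM2r e0) -expr2 (le_trans h2).
Qed.

Lemma dist_to_lipschitz x y : `|dist_to K x - dist_to K y| <= enorm (x - y).
Proof.
have h (a b : E) : dist_to K a <= enorm (a - b) + dist_to K b.
  by rewrite (le_trans (dist_to_le a (proj_in b))) // enorm_triangle.
have := h x y; have := h y x; rewrite (enormB y x) ler_norml.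
by move: (dist_to K x) (dist_to K y) (enorm _) => a b e; lra.
Qed.

(** [proj_dot] for a point q that is only near K: moving q to its projection onto K costs at most d
    times |x - p|. It is meant for q the nearest point to x in another body. *)
Lemma dot_proj_le x q (d : R) : dist_to K q <= d ->
  dot (x - proj K x) (q - proj K x) <= dist_to K x * d.
Proof.
move=> qd; rewrite -(subrKA (proj K q) q) dotDr -[leRHS]addr0.
apply: lerD; last exact: proj_dot (proj_in q).
apply: le_trans (dot_le _ _) _; rewrite -!dist_toE.
exact: (ler_wpM2l (dist_to_ge0 x) qd).
Qed.

Lemma dist_to_eq0 x : (dist_to K x == 0) = (x \in K).
Proof.
apply/idP/idP => [|/set_mem Kx].
  by rewrite dist_toE enorm_eq0 subr_eq0 => /eqP ->; exact/mem_set.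
have := dist_to_le x Kx; rewrite subrr enorm0 => h.
by apply/eqP/le_anti; rewrite h dist_to_ge0.
Qed.

Lemma parallel_bodyE (rho : R) : 0 <= rho ->
  parallel_body K rho = [set x | dist_to K x <= rho].
Proof.
move=> rho0; apply/seteqP; split=> [_ [y Ky [b b1 <-]]|x /= xr].
  rewrite /= (le_trans (dist_to_le _ Ky)) // addrC addKr enormZ ger0_norm //.
  by rewrite ler_piMr //; move: b1; rewrite /eball /= subr0.
have [r0|r0] := eqVneq rho 0.
  exists x; last by exists 0; rewrite ?scaler0 ?addr0 // /eball /= subrr enorm0.
  apply/set_mem; rewrite -dist_to_eq0; apply/eqP/le_anti.
  by rewrite dist_to_ge0 -r0 xr.
have rp : 0 < rho by rewrite lt_def r0.
exists (proj K x) => //; exists (rho^-1 *: (x - proj K x)).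
  rewrite /eball /= subr0 enormZ ger0_norm ?invr_ge0 // mulrC.
  by rewrite ler_pdivrMr // mul1r.
by rewrite scalerA mulfV // scale1r addrC subrK.
Qed.

Lemma parallel_shellE (rho : R) : 0 <= rho ->
  parallel_shell K rho = [set x | 0 < dist_to K x <= rho].
Proof.
move=> r0; rewrite /parallel_shell parallel_bodyE //.
apply/seteqP; split=> x /=.
  case=> -> Kx; rewrite andbT lt_def dist_to_ge0 andbT.
  by rewrite dist_to_eq0; apply/negP => /set_mem.
by case/andP=> x0 ->; split=> // Kx; move: x0;
  rewrite lt_def dist_to_eq0 mem_set.
Qed.

Lemma enorm_normal_dir x : 0 < dist_to K x -> enorm (normal_dir K x) = 1.
Proof.
by move=> d0; rewrite normal_dirE enormZ -dist_toE ger0_norm ?invr_ge0 ?ltW //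
  mulVf ?gt_eqF.
Qed.

End projection.

(** With s, t the norms and e the cosine of the angle, the squares are 2 - 2e on the left and (s -
    t)^2 + 2st(1 - e) on the right, where st >= 1 and e <= 1. *)
Lemma enorm_normalize_le x y : 1 <= enorm x -> 1 <= enorm y ->
  enorm ((enorm x)^-1 *: x - (enorm y)^-1 *: y) <= enorm (x - y).
Proof.
move=> x1 y1; rewrite ler_enorm ?enorm_ge0 // sqr_enorm.
set a := (enorm x)^-1; set b := (enorm y)^-1.
have xa : enorm x * a = 1 by rewrite mulfV // gt_eqF // (lt_le_trans ltr01).
have yb : enorm y * b = 1 by rewrite mulfV // gt_eqF // (lt_le_trans ltr01).
have -> : dot (a *: x - b *: y) (a *: x - b *: y) =
    (enorm x * a) ^+ 2 - 2 * (a * b * dot x y) + (enorm y * b) ^+ 2.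
  by rewrite !exprMn !sqr_enorm !dotE (dotC y x); ring.
have -> : dot (x - y) (x - y) = enorm x ^+ 2 - 2 * dot x y + enorm y ^+ 2.
  by rewrite !sqr_enorm !dotE (dotC y x); ring.
rewrite xa yb; have xy := dot_le x y.
set s := enorm x in x1 xa xy *; set t := enorm y in y1 yb xy *.
have dE : dot x y = s * t * (a * b * dot x y).
  by transitivity ((s * a) * (t * b) * dot x y); [rewrite xa yb !mul1r | ring].
have st : 1 <= s * t by nra.
have cs : a * b * dot x y <= 1.
  by rewrite -(ler_pM2l (lt_le_trans ltr01 st)) -dE mulr1.
have := sqr_ge0 (s - t).
rewrite expr1n {2}dE; move: cs; set e := a * b * _ => cs.
nra.
Qed.

Section stability.
Variables (K L : set E) (d : R).
Hypotheses (cK : convex_body K) (cL : convex_body L).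
Hypothesis KL : forall x, K x -> dist_to L x <= d.
Hypothesis LK : forall x, L x -> dist_to K x <= d.

Lemma dist_to_stability x : `|dist_to K x - dist_to L x| <= d.
Proof.
have hK : dist_to K x <= dist_to L x + d.
  apply: le_trans (dist_to_le cK x (proj_in cK (proj L x))) _.
  apply: le_trans (enorm_triangle (proj L x) _ _) _; apply: lerD => //.
  exact: (LK (proj_in cL x)).
have hL : dist_to L x <= dist_to K x + d.
  apply: le_trans (dist_to_le cL x (proj_in cL (proj K x))) _.
  apply: le_trans (enorm_triangle (proj K x) _ _) _; apply: lerD => //.
  exact: (KL (proj_in cK x)).
by move: hK hL; rewrite ler_norml; move: (dist_to K x) (dist_to L x) => a b;
  lra.
Qed.

(** With p, q the two projections, |p - q|^2 = (x - p).(q - p) + (x - q).(p - q), and [dot_proj_le]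
    bounds each term because q is within d of K and p within d of L. *)
Lemma proj_stability x :
  enorm (proj K x - proj L x) ^+ 2 <= (dist_to K x + dist_to L x) * d.
Proof.
rewrite (sqr_enorm_split x) mulrDl; apply: lerD; apply: dot_proj_le => //.
  exact: (LK (proj_in cL x)).
exact: (KL (proj_in cK x)).
Qed.

End stability.

(** The common ball bounds the distances by 2r, so that the real-valued [sup] is a true upper bound
    and not a default value. *)
Lemma hausdorff_distanceP K L (c : E) (r : R) :
  convex_body K -> convex_body L -> K `<=` eball c r -> L `<=` eball c r ->
  [/\ 0 <= hausdorff_distance K L,
      forall x, K x -> dist_to L x <= hausdorff_distance K L &
      forall x, L x -> dist_to K x <= hausdorff_distance K L].
Proof.
have infE (A B : set E) (x : E) : convex_body B ->
    inf [set enorm (x - y) | y in B] = dist_to B x.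
  move=> cB; apply/le_anti/andP; split.
    apply: ge_inf; last by exists (proj B x) => //; exact: proj_in.
    by exists 0 => _ [y _ <-]; exact: enorm_ge0.
  apply: lb_le_inf; first by exists (dist_to B x), (proj B x) => //;
    exact: proj_in.
  by move=> _ [y By <-]; exact: dist_to_le.
have supP (A B : set E) : convex_body A -> convex_body B ->
    A `<=` eball c r -> B `<=` eball c r ->
    forall x, A x -> dist_to B x <= sup [set dist_to B x | x in A].
  move=> cA cB Ac Bc x Ax; apply: ub_le_sup; last by exists x.
  exists (r + r) => _ [y Ay <-].
  rewrite (le_trans (enorm_triangle c _ _)) // lerD //; first exact: Ac.
  by rewrite enormB; exact: (Bc _ (proj_in cB _)).
move=> cK cL Kc Lc.
have -> : hausdorff_distance K L =
    Num.max (sup [set dist_to L x | x in K]) (sup [set dist_to K x | x in L]).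
  rewrite /hausdorff_distance; congr (Num.max (sup _) (sup _));
    apply: eq_imagel => x _.
    exact: infE.
  rewrite -infE //; congr (inf _); apply: eq_imagel => y _; exact: enormB.
have hK := supP _ _ cK cL Kc Lc; have hL := supP _ _ cL cK Lc Kc.
split=> [|x Kx|x Lx]; rewrite le_max.
- have [[x Kx] _ _] := cK; apply/orP; left.
  exact: le_trans (dist_to_ge0 L x) (hK x Kx).
- by rewrite (hK x Kx).
- by rewrite (hL x Lx) orbT.
Qed.

End euclidean_space.

(** * Positivity of the volume of the unit ball *)

Section volume_of_the_ball.
Context {R : realType}.

(** No measurability is assumed, since it is not established for the section volumes in [volume]: a
    nonnegative integral is a supremum over simple functions below the integrand, hence monotone in
    it. *)
Lemma ge0_le_integralT (f g : R -> \bar R) :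
  (forall t, 0 <= f t)%E -> (forall t, f t <= g t)%E ->
  (\int[lebesgue_measure]_(t in [set: R]) f t <=
   \int[lebesgue_measure]_(t in [set: R]) g t)%E.
Proof.
move=> f0 fg; have g0 t : (0 <= g t)%E by exact: le_trans (f0 t) (fg t).
rewrite !ge0_integralTE //; apply: le_ereal_sup => _ [h hf <-].
by exists h => // t; exact: le_trans (hf t) (fg t).
Qed.

Lemma volume_ge0 (n : nat) (A : set 'rV[R]_n) : (0 <= volume A)%E.
Proof.
elim: n A => [|n IHn] A /=; last exact: integral_ge0.
by rewrite lee_fin.
Qed.

Lemma le_volume (n : nat) (A B : set 'rV[R]_n) :
  A `<=` B -> (volume A <= volume B)%E.
Proof.
elim: n A B => [|n IHn] A B AB /=.
  rewrite lee_fin !indicE; case: (boolP (_ \in A)) => // /set_mem/AB Bx.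
  by rewrite mem_set.
apply: ge0_le_integralT => t; first exact: volume_ge0.
by apply: IHn => y /AB.
Qed.

Lemma volume0 (n : nat) : volume (set0 : set 'rV[R]_n) = 0%E.
Proof.
elim: n => [|n IHn] /=; first by rewrite indic0.
by apply: integral0_eq => t _.
Qed.

Lemma volume_cube (n : nat) (a : R) : 0 <= a ->
  volume [set y : 'rV[R]_n | forall i, `|y 0 i| <= a] = ((2 * a) ^+ n)%:E.
Proof.
move=> a0; elim: n => [|n IHn] /=.
  by rewrite indicE mem_set //= => -[].
transitivity (\int[lebesgue_measure]_(t in [set: R])
    ((2 * a) ^+ n * \1_`[- a, a] t)%:E)%E.
  apply: eq_integral => t _; rewrite indicE.
  have cubeE (y : 'rV[R]_n) :
      (forall i : 'I_n.+1, `|row_mx (t%:M : 'M[R]_1) y 0 i| <= a) <->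
      (`|t| <= a /\ forall i, `|y 0 i| <= a).
    have row0 : row_mx (t%:M : 'M[R]_1) y 0 (lshift n 0) = t.
      by rewrite row_mxEl mxE eqxx.
    have rowS i : row_mx (t%:M : 'M[R]_1) y 0 (rshift 1 i) = y 0 i.
      by rewrite row_mxEr.
    split=> [h|[h0 hS] i].
      by split=> [|i]; [rewrite -row0; exact: h|rewrite -rowS; exact: h].
    by case: (@split_ordP 1 n i) => j ->; rewrite ?rowS // ord1 row0.
  have [/set_mem /= ta|ta] := boolP (t \in _).
    rewrite mulr1 -IHn; congr volume; apply/seteqP; split=> y /=.
      by move/cubeE => [].
    by move=> h; apply/cubeE; split=> //; move: ta; rewrite in_itv /= ler_norml.
  transitivity (volume (set0 : set 'rV[R]_n)); last by rewrite volume0 mulr0.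
  congr volume; apply/seteqP; split=> // y /=.
  move/cubeE => [h _]; case/negP: ta; apply/mem_set.
  by rewrite /= in_itv /= -ler_norml.
under eq_integral do rewrite EFinM.
rewrite ge0_integralZl //; last 2 first.
- by apply/measurable_EFinP; exact: measurable_indic.
- by rewrite lee_fin exprn_ge0 // mulr_ge0.
rewrite integral_indic // setIT.
have itvE : lebesgue_measure (`[- a, a]%classic : set R) = (2 * a)%:E.
  rewrite lebesgue_measure_itv /= lte_fin; case: ltP => [_|h].
    by rewrite -EFinB; congr EFin; ring.
  by have -> : a = 0 by [lra]; rewrite mulr0.
by rewrite exprSr [RHS]EFinM; congr (_ * _)%E; exact: itvE.
Qed.

Lemma kappa_ge0 (n : nat) : 0 <= kappa R n.
Proof. by rewrite fine_ge0 // volume_ge0. Qed.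

(** The ball lies between cubes of half-side 1/(n+1) and 1: the inner one gives positivity, the
    outer one finiteness, without which [fine] would return 0. *)
Lemma kappa_gt0 (n : nat) : 0 < kappa R n.
Proof.
have lb : (((2 * n.+1%:R^-1) ^+ n)%:E <= volume (eball (0 : 'rV[R]_n) 1))%E.
  rewrite -volume_cube ?invr_ge0 //; apply: le_volume => y /= h.
  rewrite /eball /= subr0 (le_trans (enorm_le_coord h)) // ler_pdivrMr // mul1r.
  by rewrite ler_nat.
have ub : (volume (eball (0 : 'rV[R]_n) 1) <= ((2 * 1) ^+ n)%:E)%E.
  rewrite -volume_cube //; apply: le_volume => y yb i.
  by apply: le_trans (coord_le_enorm y i) _; rewrite -[y]subr0; exact: yb.
apply: fine_gt0; rewrite (le_lt_trans ub) ?ltry // andbT.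
by rewrite (lt_le_trans _ lb) // lte_fin exprn_gt0 // mulr_gt0.
Qed.

End volume_of_the_ball.

(** * Hausdorff measure *)

Section hausdorff_measure.
Context (R : realType) (n' : nat).
Local Notation n := n'.+1.
Local Notation E := 'rV[R]_n.
Local Open Scope ereal_scope.
Implicit Types (A B X : set E) (delta : R).

Let gauge A : \bar R := (kappa R n / 2 ^+ n)%:E * diameter A ^+ n.

Lemma diameter_ge0 A : 0 <= diameter A.
Proof. by rewrite le_max lexx. Qed.

Lemma diameter0 : diameter (set0 : set E) = 0.
Proof.
rewrite /diameter (_ : [set _ | _ in _] = set0) ?ereal_sup0 ?maxeNy //.
by apply/seteqP; split=> // _ [? [[]]].
Qed.

Let gauge_ge0 A : 0 <= gauge A.
Proof.
rewrite mule_ge0 ?expe_ge0 ?diameter_ge0 // lee_fin.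
by rewrite divr_ge0 ?kappa_ge0 ?exprn_ge0.
Qed.
Hint Resolve gauge_ge0 : core.

(** Holds because the dimension is positive. Members of a cover can thus be replaced by [set0], and
    finite covers padded with it, at no cost. *)
Let gauge0 : gauge set0 = 0.
Proof. by rewrite /gauge diameter0 expeS mul0e mule0. Qed.

Let pre_le delta A (C : (set E)^nat) :
  A `<=` \bigcup_k C k -> (forall k, diameter (C k) <= delta%:E) ->
  hausdorff_pre delta A <= \sum_(0 <= k <oo) gauge (C k).
Proof. by move=> AC Cd; apply: ereal_inf_lbound; exists C. Qed.

Let pre_ge0 delta A : 0 <= hausdorff_pre delta A.
Proof. by apply: le_ereal_inf_tmp => _ [C _ <-];
  apply: nneseries_ge0 => k _ _; exact: gauge_ge0. Qed.
Hint Resolve pre_ge0 : core.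

Let le_pre delta A B : A `<=` B -> hausdorff_pre delta A
  <= hausdorff_pre delta B.
Proof.
move=> AB; apply: le_ereal_inf_tmp => _ [C [BC Cd] <-].
by apply: pre_le => //; exact: subset_trans BC.
Qed.

Let pre_anti (d d' : R) A : (d <= d')%R -> hausdorff_pre d' A
  <= hausdorff_pre d A.
Proof.
move=> dd'; apply: le_ereal_inf_tmp => _ [C [AC Cd] <-].
by apply: pre_le => // k; rewrite (le_trans (Cd k)).
Qed.

Let pre_hausdorff delta A : (0 < delta)%R ->
  hausdorff_pre delta A <= hausdorff_measure A.
Proof. by move=> d0; apply: ereal_sup_ubound; exists delta. Qed.

Let pre_sigma_subadditive delta : (0 <= delta)%R ->
  sigma_subadditive (@hausdorff_pre R n' delta).
Proof.
move=> d0 A; have [[i ioo]|] := pselect (exists i,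
  hausdorff_pre delta (A i) = +oo).
  rewrite (eseries_pinfty _ _ ioo) ?leey // => k _.
  by rewrite -ltNye (lt_le_trans _ (pre_ge0 _ _)).
rewrite -forallNE => Aoo; apply/lee_addgt0Pr => e e0.
rewrite (le_trans _ (epsilon_trick _ _ (ltW e0))) //.
pose P k (C : (set E)^nat) := [/\ A k `<=` \bigcup_j C j,
  forall j, diameter (C j) <= delta%:E &
  \sum_(0 <= j <oo) gauge (C j) <= hausdorff_pre delta (A k) + (e / (2 ^
    k.+1)%:R)%:E].
have [G PG] : {G : ((set E)^nat)^nat & forall k, P k (G k)}.
  apply: (@choice _ _ P) => k.
  have fin : hausdorff_pre delta (A k) \is a fin_num.
    by rewrite ge0_fin_numE // ltey; apply/eqP.
  have ek : (0 < e / (2 ^ k.+1)%:R)%R by rewrite divr_gt0 // ltr0n expn_gt0.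
  have [_ [C [AC Cd] <-] Clt] := lb_ereal_inf_adherent ek fin.
  by exists C; split=> //; exact: ltW.
(* A bijection between nat and pairs flattens the covers of all the A k into one sequence, as
   [hausdorff_pre] requires. *)
have /card_esym/ppcard_eqP[f] := card_nat2.
pose g (ij : nat * nat) := gauge (G ij.1 ij.2).
have gE : \sum_(0 <= k <oo) g (f k) = \sum_(i <oo) \sum_(0
  <= j <oo) gauge (G i j).
  rewrite [LHS]nneseries_esumT; last by move=> k; exact: gauge_ge0.
  under [RHS]eq_eseriesr do rewrite nneseries_esumT //.
  rewrite [RHS]nneseries_esumT; last by move=> k; exact: esum_ge0.
  rewrite (@esum_esum _ _ _ setT (fun=> setT) (fun i j => gauge (G i j))) //.
  rewrite -(@reindex_esum _ _ _ setT (setT `*`` (fun=> setT)) f g) //.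
  split=> [k _ //|i j _ _ fij|ij _].
    by have := congr1 f^-1%FUN fij; rewrite !funK ?inE.
  by exists (f^-1%FUN ij) => //; rewrite invK ?inE.
apply: (@le_trans _ _ (\sum_(0 <= k <oo) g (f k))).
  apply: (@pre_le _ _ (fun k => G (f k).1 (f k).2)) => [x [k _ Akx]|k];
    last by have [_ + _] := PG (f k).1; exact.
  have [/(_ _ Akx)[j _ Gx] _ _] := PG k.
  by exists (f^-1%FUN (k, j)) => //=; rewrite invK ?inE.
rewrite gE; apply: lee_nneseries => k _; first by move=> _;
  exact: nneseries_ge0.
by have [] := PG k.
Qed.

Let hausdorff0 : hausdorff_measure (set0 : set E) = 0.
Proof.
apply/le_anti/andP; split; last first.
  by apply: le_trans (pre_hausdorff set0 ltr01); exact: pre_ge0.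
apply: ge_ereal_sup => _ [delta d0 <-].
apply: (@le_trans _ _ (\sum_(0 <= k <oo) gauge set0)).
  by apply: (@pre_le _ _ (fun=> set0)) => [x //|k];
    rewrite diameter0 lee_fin ltW.
by rewrite eseries0.
Qed.

Let hausdorff_ge0 A : 0 <= hausdorff_measure A.
Proof. exact: le_trans (pre_ge0 1 A) (pre_hausdorff _ ltr01). Qed.

Let le_hausdorff : {homo (@hausdorff_measure R n') : A B / A `<=` B >-> A <= B}.
Proof.
move=> A B AB; apply: ge_ereal_sup => _ [delta d0 <-].
exact: le_trans (le_pre _ AB) (pre_hausdorff _ d0).
Qed.

Let hausdorff_sigma_subadditive : sigma_subadditive (@hausdorff_measure R n').
Proof.
move=> A; apply: ge_ereal_sup => _ [delta d0 <-].
apply: le_trans (pre_sigma_subadditive (ltW d0) A) _.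
by apply: lee_nneseries => // k _; exact: pre_hausdorff.
Qed.

HB.instance Definition _ := isOuterMeasure.Build R E (@hausdorff_measure R n')
  hausdorff0 hausdorff_ge0 le_hausdorff hausdorff_sigma_subadditive.

(* A constant of outer measure type: the measure instance on its Caratheodory
   type is keyed on the coercion to functions. *)
Definition hausdorff_outer : {outer_measure set E -> \bar R} :=
  @hausdorff_measure R n'.

(** The metric outer measure property: a set of diameter less than e cannot meet both A and B, so a
    fine cover of the union splits into a cover of A and a cover of B. *)
Lemma hausdorff_measureU A B (e : R) : (0 < e)%R ->
  (forall x y, A x -> B y -> e <= enorm (x - y))%R ->
  hausdorff_measure A + hausdorff_measure B <= hausdorff_measure (A `|` B).
Proof.
move=> e0 AB; set H := hausdorff_measure (A `|` B).
have preU d : (0 < d < e)%R -> hausdorff_pre d A + hausdorff_pre d B <= H.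
  move=> /andP[d0 de]; apply: le_trans (pre_hausdorff _ d0).
  apply: le_ereal_inf_tmp => _ [C [ABC Cd] <-].
  pose CA k := if pselect (C k `&` A !=set0) then C k else set0.
  pose CB k := if pselect (C k `&` B !=set0) then C k else set0.
  have gAB k : gauge (CA k) + gauge (CB k) <= gauge (C k).
    rewrite /CA /CB; case: pselect => [[x [Cx Ax]]|?] /=; last first.
      by rewrite gauge0 add0e; case: pselect => //= ?; rewrite gauge0.
    case: pselect => [[y [Cy By]]|?] /=; last by rewrite gauge0 adde0.
    have : (enorm (x - y))%:E <= diameter (C k).
      by rewrite le_max ereal_sup_ubound ?orbT //; exists (x, y).
    move=> /le_trans/(_ (Cd k)); rewrite lee_fin leNgt.
    by rewrite (lt_le_trans de) // AB.
  apply: (@le_trans _ _ (\sum_(0 <= k <oo) (gauge (CA k) + gauge (CB k)))).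
    rewrite nneseriesD //; apply: leeD; apply: pre_le => [x Ax|k].
    - have [k _ Ckx] := ABC x (or_introl Ax).
      exists k => //; rewrite /CA; case: pselect => // -[].
      by exists x.
    - by rewrite /CA; case: pselect => //= ?; rewrite diameter0 lee_fin ltW.
    - have [k _ Ckx] := ABC x (or_intror Ax).
      exists k => //; rewrite /CB; case: pselect => // -[].
      by exists x.
    - by rewrite /CB; case: pselect => //= ?; rewrite diameter0 lee_fin ltW.
  apply: lee_nneseries => k _; last exact: gAB.
  by move=> _; apply: adde_ge0; exact: gauge_ge0.
have [->|Hoo] := eqVneq H +oo; first by rewrite leey.
have fin X : X `<=` A `|` B -> hausdorff_measure X \is a fin_num.
  move=> XAB; rewrite ge0_fin_numE ?hausdorff_ge0 //.
  by rewrite (le_lt_trans (le_hausdorff XAB)) // ltey.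
have finp d X : (0 < d)%R -> X `<=` A `|` B -> hausdorff_pre d X \is a fin_num.
  move=> d0 XAB; rewrite ge0_fin_numE // (le_lt_trans (pre_hausdorff X d0)) //.
  by rewrite -ge0_fin_numE ?hausdorff_ge0 // fin.
have sA : A `<=` A `|` B by move=> x; left.
have sB : B `<=` A `|` B by move=> x; right.
(* The two suprema are taken one after the other, hence two independent scales; both reduce to their
   minimum with e / 2, as [hausdorff_pre] decreases in the scale. *)
have pre2 d d' : (0 < d)%R -> (0 < d')%R ->
    hausdorff_pre d A + hausdorff_pre d' B <= H.
  move=> d0 d'0; pose m := (Num.min (Num.min d d') (e / 2))%R.
  have m0 : (0 < m)%R by rewrite !lt_min d0 d'0 divr_gt0.
  have me : (m < e)%R by rewrite gt_min ltr_pdivrMr //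
    mulr_natr mulr2n ltrDl e0 orbT.
  apply: le_trans (preU m _); last by rewrite m0 me.
  by apply: leeD; apply: pre_anti; rewrite !ge_min lexx ?orbT.
rewrite -leeBrDr ?fin //; apply: ge_ereal_sup => _ [d d0 <-].
rewrite leeBrDr ?fin // addeC -leeBrDr ?finp //.
apply: ge_ereal_sup => _ [d' d'0 <-].
by rewrite leeBrDr ?finp // addeC pre2.
Qed.

Lemma diameter_le A (d : R) : (0 <= d)%R ->
  (forall x y, A x -> A y -> enorm (x - y) <= d)%R -> diameter A <= d%:E.
Proof.
move=> d0 Ad; rewrite ge_max lee_fin d0 /=.
by apply: ge_ereal_sup => _ [[x y] [Ax Ay] <-]; rewrite lee_fin Ad.
Qed.

Let pre_seq (delta d : R) A (L : seq (set E)) : (0 <= d <= delta)%R ->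
  A `<=` \bigcup_k nth set0 L k ->
  (forall k x y, nth set0 L k x -> nth set0 L k y -> enorm (x - y) <= d)%R ->
  hausdorff_pre delta A <= ((size L)%:R * (kappa R n / 2 ^+ n * d ^+ n))%:E.
Proof.
move=> /andP[d0 dd] AL Ld.
have diamL k : diameter (nth set0 L k) <= d%:E by apply: diameter_le =>
  // x y; exact: Ld.
apply: le_trans (pre_le AL _) _ => [k|]; first by rewrite (le_trans (diamL k)).
rewrite (nneseries_split 0 (size L)) //.
rewrite add0n [X in _ + X]eseries0 ?adde0; last first.
  by move=> k Lk _; rewrite nth_default // gauge0.
rewrite (@le_trans _ _ (\sum_(0 <= k < size L) (kappa R n / 2 ^+ n * d ^+
  n)%:E)) //.
  apply: lee_sum => k _; rewrite /gauge [leRHS]EFinM; apply: lee_wpmul2l.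
    by rewrite lee_fin divr_ge0 ?kappa_ge0 ?exprn_ge0.
  have: (forall m, diameter (nth set0 L k) ^+ m <= (d ^+ m)%:E); last exact.
  elim=> [|m IHm]; first by rewrite expe0 expr0.
  by rewrite expeS exprS [leRHS]EFinM; apply: lee_pmul;
    rewrite ?expe_ge0 ?diameter_ge0.
by rewrite big_mkord sumEFin sumr_const card_ord mulr_natl.
Qed.

(** From a grid of (N+1)^n cells of side s = 2p/N and diameter at most n s, with p = |r| + 1: the
    total is at most kappa/2^n (n (N+1) s)^n, and (N+1) s <= 2 N s = 4p. *)
Definition ball_bound (r : R) : R :=
  (kappa R n / 2 ^+ n * (4 * n%:R * (`|r| + 1)) ^+ n)%R.

Lemma ball_bound_ge0 r : (0 <= ball_bound r)%R.
Proof.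
by rewrite !mulr_ge0 ?invr_ge0 ?kappa_ge0 ?exprn_ge0 ?mulr_ge0 ?addr_ge0.
Qed.

Lemma hausdorff_measure_eball (c : E) r :
  hausdorff_measure (eball c r) <= (ball_bound r)%:E.
Proof.
apply: ge_ereal_sup => _ [delta d0 <-].
set p : R := (`|r| + 1)%R; have p0 : (0 < p)%R by rewrite ltr_pwDr.
(* Large enough that the cell diameter n s is at most delta. *)
pose N := (Num.truncn (n%:R * (2 * p) / delta)).+1.
have N0 : (0 < N%:R :> R)%R by rewrite ltr0n.
pose s : R := (2 * p / N%:R)%R.
have s0 : (0 < s)%R by rewrite divr_gt0 ?mulr_gt0.
have sN : (s * N%:R = 2 * p)%R by rewrite mulfVK ?gt_eqF.
have sd : (0 <= n%:R * s <= delta)%R.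
  rewrite mulr_ge0 ?(ltW s0) //= /s mulrA ler_pdivrMr //
    [leRHS]mulrC -ler_pdivrMr //.
  exact/ltW/truncnS_gt.
(* The ball is covered by (N + 1)^n cells of side s = 2 p / N. *)
pose cell (j : {ffun 'I_n -> 'I_N.+1}) : set E :=
  [set x | forall i, ((j i)%:R * s <= x 0 i - c 0 i + p
    <= ((j i)%:R + 1) * s)%R].
pose L := [seq cell j | j <- enum {ffun 'I_n -> 'I_N.+1}].
have sL : size L = (N.+1 ^ n)%N by rewrite size_map -cardT card_ffun !card_ord.
apply: le_trans (@pre_seq delta (n%:R * s)%R (eball c r) L sd _ _) _.
- move=> x xr.
  have xi i : (0 <= x 0 i - c 0 i + p <= 2 * p)%R.
    have := le_trans (coord_le_enorm (x - c) i) xr; rewrite !mxE ler_norml /p.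
    by have := ler_norm r; lra.
  (* The right end 2p of the interval falls into cell number N, whence N + 1 cells per axis. *)
  have ji i : (Num.truncn ((x 0 i - c 0 i + p) / s)%R < N.+1)%N.
    have /andP[x0 x1] := xi i.
    rewrite ltnS -(ler_nat R); apply: (@le_trans _ _ ((x 0 i - c 0 i + p) /
      s)%R).
      by rewrite truncn_le divr_ge0 ?(ltW s0).
    by rewrite ler_pdivrMr // mulrC sN.
  pose j := [ffun i => Ordinal (ji i)].
  have jL : cell j \in L by apply: map_f; rewrite mem_enum.
  exists (index (cell j) L) => //; rewrite nth_index // => i; rewrite ffunE /=.
  have /andP[x0 x1] := xi i.
  rewrite -ler_pdivlMr // truncn_le divr_ge0 ?(ltW s0) //=.
  by rewrite -ler_pdivrMr // natr1 ltW // truncnS_gt.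
- move=> k x y; have [kL|Lk] := ltnP k (size L); last by rewrite nth_default.
  have /mapP[j _ ->] := mem_nth set0 kL => xj yj.
  apply: enorm_le_coord => i; have := xj i; have := yj i.
  by rewrite !mxE ler_norml; lra.
rewrite lee_fin sL /ball_bound mulrCA ler_wpM2l ?divr_ge0 ?kappa_ge0 ?exprn_ge0
  //.
rewrite natrX -exprMn lerXn2r ?nnegrE ?mulr_ge0 ?(ltW s0) ?(ltW p0) //.
rewrite -/p; have -> : (4 * n%:R * p = n%:R * (2 * (s * N%:R)))%R by rewrite
  sN; ring.
rewrite mulrCA ler_wpM2l // mulrC [leRHS]mulrCA ler_wpM2l ?(ltW s0) //.
by rewrite -natr1; have : (1 <= N%:R :> R)%R by [rewrite ler1n]; lra.
Qed.

(** Caratheodory's criterion for metric outer measures. The part A k of X where g > 1/(k+1) is at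
    positive distance from the part where g <= 0, so the measures of these two add up; it remains to
    see that the measure of A k tends to that of X [&] G. *)
Lemma lipschitz_caratheodory (g : E -> R) :
  (forall x y, `|g x - g y| <= enorm (x - y))%R ->
  measurable ([set x | (0 < g x)%R] : set (caratheodory_type hausdorff_outer)).
Proof.
move=> g1; apply: le_caratheodory_measurable => X; set G := [set x | _].
suff : hausdorff_measure (X `&` G) + hausdorff_measure (X `&` ~` G) <=
  hausdorff_measure X by [].
have [->|Xoo] := eqVneq (hausdorff_measure X) +oo; first by rewrite leey.
have fin A : A `<=` X -> hausdorff_measure A \is a fin_num.
  move=> AX; rewrite ge0_fin_numE ?hausdorff_ge0 //.
  by rewrite (le_lt_trans (le_hausdorff AX)) // ltey.
have sep (s t : R) A B : (s < t)%R -> (forall x, A x -> t < g x)%R ->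
    (forall x, B x -> g x <= s)%R ->
    hausdorff_measure A + hausdorff_measure B <= hausdorff_measure (A `|` B).
  move=> st At Bs; apply: (@hausdorff_measureU A B (t - s)%R) =>
    [|x y /At tx /Bs ys].
    by rewrite subr_gt0.
  by have := le_trans (ler_norm _) (g1 x y); lra.
pose t k : R := (k.+1%:R^-1)%R.
have t_gt0 k : (0 < t k)%R by rewrite invr_gt0.
have t_anti k : (t k.+1 < t k)%R by rewrite ltf_pV2 ?posrE // ltr_nat.
pose A k := X `&` [set x | (t k < g x)%R].
pose D k := X `&` [set x | (t k.+2 < g x <= t k.+1)%R].
have sAX k : A k `<=` X by move=> x [].
have sDX k : D k `<=` X by move=> x [].
pose r k := fine (hausdorff_measure (A k)).
have rE k : hausdorff_measure (A k) = (r k)%:E by rewrite fineK // fin.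
pose b := fine (hausdorff_measure (X `&` ~` G)).
have bE : hausdorff_measure (X `&` ~` G) = b%:E by rewrite fineK // fin //
  => x [].
pose M := fine (hausdorff_measure X).
have ME : hausdorff_measure X = M%:E by rewrite fineK // fin.
have rb k : (r k + b <= M)%R.
  rewrite -lee_fin EFinD -rE -bE -ME.
  apply: le_trans (@sep 0%R (t k) _ _ (t_gt0 k) _ _) _.
  - by move=> x [].
  - by move=> x [_ /negP]; rewrite -leNgt.
  - by apply: le_hausdorff => x [[]|[]].
(* D k and A k are at a positive distance from each other, so the measures of
   the D k are dominated by a telescoping sequence. *)
have rD k : hausdorff_measure (D k) <= (r k.+2 - r k)%:E.
  rewrite EFinB leeBrDr // -!rE addeC.
  apply: le_trans (@sep (t k.+1) (t k) _ _ (t_anti k) _ _) _.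
  - by move=> x [].
  - by move=> x [_ /andP[]].
  - apply: le_hausdorff => x [[Xx tx]|[Xx /andP[tx _]]]; split=> //.
    by apply: lt_trans tx; exact: lt_trans (t_anti k.+1) (t_anti k).
pose S := sup (range r).
have rS k : (r k <= S)%R.
  apply: ub_le_sup; last by exists k.
  by exists (M - b)%R => _ [j _ <-]; rewrite lerBrDr.
have Sb : (S + b <= M)%R.
  rewrite -lerBrDr; apply: ge_sup; first by exists (r 0%N), 0%N.
  by move=> _ [j _ <-]; rewrite lerBrDr.
(* X [&] G is A (m+1) together with the layers D k for k >= m. The sum of r (k+2) - r k telescopes
   in steps of two and is at most 2S - r (m+1) - r m. *)
have tail m : hausdorff_measure (X `&` G) <= (2 * S - r m)%:E.
  have sub : X `&` G `<=` A m.+1 `|` \bigcup_(k in ~` `I_m) D k.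
    move=> x [Xx Gx].
    have [tx|xt] := ltP (t m.+1) (g x); [by left|right].
    have exk : exists k, (t k.+2 < g x)%R.
      exists (Num.truncn (g x)^-1)%R.
      rewrite invf_plt ?posrE //; apply: lt_trans (truncnS_gt _) _.
      by rewrite ltr_nat ltnW.
    have [k Pk kmin] := ex_minnP exk.
    have mk : (m <= k)%N.
      rewrite leqNgt; apply/negP => km; move: Pk; rewrite ltNge.
      rewrite (le_trans xt) // lef_pV2 ?posrE // ler_nat.
      by rewrite ltnS.
    exists k; first by apply/negP; rewrite -leqNgt.
    split=> //; apply/andP; split=> //.
    case: k Pk kmin mk => [|k] _ kmin mk.
      by move: mk xt; rewrite leqn0 => /eqP ->.
    by rewrite leNgt; apply/negP => /kmin; rewrite ltnn.
  apply: le_trans (le_hausdorff sub) _.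
  apply: le_trans (_ : hausdorff_measure (A m.+1) +
      hausdorff_measure (\bigcup_(k in ~` `I_m) D k) <= _).
    exact: outer_measureU2.
  have -> : (2 * S - r m = r m.+1 + (2 * S - r m - r m.+1))%R by ring.
  rewrite EFinD rE leeD2l //.
  apply: le_trans (_ : \sum_(m <= k <oo) hausdorff_measure (D k) <= _).
    exact: outer_measure_sigma_subadditive_tail.
  apply: lime_le; first by apply: is_cvg_nneseries => k _ _;
    exact: hausdorff_ge0.
  apply: nearW => N; have [Nm|mN] := leqP N m.
    rewrite big_geq // lee_fin; have := rS m; have := rS m.+1; lra.
  apply: le_trans (_ : (\sum_(m <= k < N) (r k.+2 - r k))%:E <= _).
    by rewrite -sumEFin; apply: lee_sum => k _.
  rewrite lee_fin (_ : (\sum_(m <= k < N) _ = r N.+1 + r N - r m.+1 - r m)%R).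
    by have := rS N; have := rS N.+1; lra.
  rewrite -(subnKC (ltnW mN)); elim: (N - m)%N => [|j IHj].
    by rewrite addn0 big_geq //; ring.
  by rewrite addnS big_nat_recr ?leq_addr //= IHj; ring.
apply: le_trans (_ : S%:E + b%:E <= _); last by rewrite -EFinD ME lee_fin.
rewrite bE leeD2r //; apply/lee_addgt0Pr => e e0.
(* For r m > S - e the tail bound 2S - r m is below S + e. *)
have [_ [m _ <-] rm] : exists2 y, range r y & (S - e < y)%R.
  apply: sup_adherent => //; split; first by exists (r 0%N), 0%N.
  by exists S => _ [k _ <-].
by apply: le_trans (tail m) _; rewrite -EFinD lee_fin; lra.
Qed.

End hausdorff_measure.

(** * The map sending x to (p_K(x), u_K(x)) *)

Section normal_pairs.
Context {R : realType} {n' : nat}.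
Local Notation n := n'.+1.
Local Notation E := 'rV[R]_n.
Local Notation T := (caratheodory_type (hausdorff_outer R n')).

(** The distance to the complement is 1-Lipschitz and positive exactly on U. The whole space is set
    apart because there the infimum would run over the empty set. *)
Lemma open_caratheodory (U : set E) : open U -> measurable (U : set T).
Proof.
move=> oU; have [[y0 y0U]|UT] := pselect (~` U !=set0); last first.
  have -> : U = setT.
    by apply/seteqP; split=> // x _; apply: contrapT => Ux; apply: UT; exists x.
  exact: (@measurableT _ T).
pose D x := [set enorm (x - y) | y in ~` U].
have Dlb x : has_lbound (D x) by exists 0 => _ [y _ <-]; exact: enorm_ge0.
have D0 x : D x !=set0 by exists (enorm (x - y0)), y0.
have infD x y : inf (D x) <= enorm (x - y) + inf (D y).
  rewrite -lerBlDl; apply: lb_le_inf => // _ [z zU <-].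
  rewrite lerBlDl (le_trans _ (enorm_triangle y x z)) //.
  by apply: ge_inf => //; exists z.
have -> : U = [set x | 0 < inf (D x)].
  apply/seteqP; split=> x /=.
    move=> Ux; have /nbhs_enormP[e e0 eU] := open_nbhs_nbhs (conj oU Ux).
    apply: (lt_le_trans e0); apply: lb_le_inf => // _ [y yU <-].
    by rewrite leNgt; apply/negP => /eU.
  move=> Dx; apply: contrapT => xU.
  have : inf (D x) <= enorm (x - x) by apply: ge_inf => //; exists x.
  by rewrite subrr enorm0 leNgt Dx.
apply: lipschitz_caratheodory => x y.
by have := infD x y; have := infD y x; rewrite (enormB y x) ler_norml; lra.
Qed.

Lemma lipschitz_measurable_gt (g : E -> R) (t : R) :
  (forall x y, `|g x - g y| <= enorm (x - y)) ->
    measurable ([set x | t < g x] : set T).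
Proof.
move=> g1; rewrite (_ : [set x | _] = [set x | 0 < g x - t]).
  apply: lipschitz_caratheodory => x y; rewrite opprB addrA subrK; exact: g1.
by apply/seteqP; split=> x /=; rewrite subr_gt0.
Qed.

(* Constant on K, where normal_dir is the junk value 0. *)
Definition normal_pair (K : set E) (x : E) : Sigma_borel R n' :=
  if pselect (Sigma_set (proj K x, normal_dir K x)) is left h
  then exist (fun p => p \in @Sigma_set R n') _ (mem_set h) else point.

Section convex_body.
Variable K : set E.
Hypothesis cK : convex_body K.

Lemma normal_pairE x : 0 < dist_to K x ->
  Sigma_val (normal_pair K x) = (proj K x, normal_dir K x).
Proof.
move=> d0; rewrite /normal_pair; case: pselect => // -[].
exact: enorm_normal_dir.
Qed.

Lemma normal_pair_point x : dist_to K x = 0 -> normal_pair K x = point.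
Proof.
move=> d0; rewrite /normal_pair; case: pselect => // h; exfalso.
move: h; rewrite /Sigma_set /= normal_dirE d0 invr0 scale0r enorm0 => /eqP.
by rewrite eq_sym oner_eq0.
Qed.

Lemma normal_dir_continuous x : 0 < dist_to K x ->
  {for x, continuous (normal_dir K)}.
Proof.
move=> d0; rewrite /continuous_at.
have -> : normal_dir K = (fun x => (dist_to K x)^-1 *: (x - proj K x)).
  by apply/funext => y; exact: normal_dirE.
apply: (@cvgZ _ _ _ (nbhs x)).
  apply: cvgV; first by rewrite gt_eqF.
  by apply: (@enorm_lipschitz_cvg _ _ _ 1) => y z;
    rewrite mul1r dist_to_lipschitz.
apply: cvgB; first exact: cvg_id.
by apply: (@enorm_lipschitz_cvgV _ _ _ 1) => y z;
  rewrite mul1r proj_nonexpansive.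
Qed.

Lemma nbhs_dist_to_gt0 x : 0 < dist_to K x -> nbhs x [set y | 0 < dist_to K y].
Proof.
move=> dx; apply/nbhs_enormP; exists (dist_to K x); first exact: dx.
move=> y xy; have := le_trans (ler_norm _) (dist_to_lipschitz cK x y).
move/le_lt_trans/(_ xy); rewrite ltrBlDr -[X in X < _ -> _]addr0.
by rewrite ltrD2l; exact.
Qed.

(** The preimage of an open set is split along K: outside K the map is continuous and the piece is
    open, on K the map is constant and the piece is all or nothing. *)
Lemma measurable_normal_pair : measurable_fun [set: T] (normal_pair K : T ->
  Sigma_borel R n').
Proof.
apply: (@measurability _ _ T (Sigma_borel R n') setT (normal_pair K) (@open
  (Sigma R n'))) => //.
move=> _ [W oW <-]; rewrite setTI.
have mK : measurable ([set x | 0 < dist_to K x] : set T).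
  by apply: lipschitz_measurable_gt => x y; exact: dist_to_lipschitz.
rewrite -[_ @^-1` _](setUIDK _ [set x | 0 < dist_to K x]).
apply: measurableU.
  case: oW => V oV VW; apply: open_caratheodory; rewrite openE => x /= [Wx Kx].
  have Wval y : 0 < dist_to K y -> W (normal_pair K y) = V (proj K y,
    normal_dir K y).
    by move=> dy; rewrite -normal_pairE // -VW.
  have Vx : nbhs (proj K x, normal_dir K x) V.
    by apply: open_nbhs_nbhs; split=> //; rewrite -Wval.
  have cpair : (proj K y, normal_dir K y) @[y --> x] --> (proj K x,
    normal_dir K x).
    apply: (@cvg_pair _ _ _ (nbhs x) (nbhs (proj K x)) (nbhs (normal_dir K
      x))); last exact: normal_dir_continuous.
    by apply: (@enorm_lipschitz_cvgV _ _ _ 1) => y z;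
      rewrite mul1r proj_nonexpansive.
  have dpos := nbhs_dist_to_gt0 Kx.
  apply: filterS (filterI dpos (cpair _ Vx)) => y /= [dy Vy].
  by split; [rewrite Wval; [exact: Vy|exact: dy]|exact: dy].
have [Wp|Wp] := pselect (W point).
  rewrite (_ : _ `\` _ = ~` [set x | 0 < dist_to K x]);
    first exact: measurableC.
  apply/seteqP; split=> x /= => [[]//|dx]; split=> //.
  rewrite normal_pair_point //; apply/le_anti; rewrite dist_to_ge0 andbT leNgt.
  exact/negP.
rewrite (_ : _ `\` _ = set0) //; apply/seteqP; split=> x //= [+ /negP].
rewrite -leNgt => + dx; rewrite normal_pair_point //.
by apply/le_anti; rewrite dist_to_ge0 dx.
Qed.

End convex_body.
End normal_pairs.

(** * Lipschitz functions on the normal bundle space Sigma *)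

Section lipschitz_on_Sigma.
Context {R : realType} {n' : nat}.
Local Notation n := n'.+1.
Local Notation E := 'rV[R]_n.
Implicit Types (s t : Sigma R n') (f : Sigma R n' -> R).

Lemma Sigma_dist_le s t :
  Sigma_dist s t <= enorm ((Sigma_val s).1 - (Sigma_val t).1) +
                    enorm ((Sigma_val s).2 - (Sigma_val t).2).
Proof.
rewrite /Sigma_dist; set a := enorm _; set b := enorm (_.2 - _).
have a0 : 0 <= a := enorm_ge0 _; have b0 : 0 <= b := enorm_ge0 _.
rewrite -[leRHS]ger0_norm ?addr_ge0 // -sqrtr_sqr ler_sqrt ?sqr_ge0 //.
by rewrite sqrrD; nra.
Qed.

Lemma lip_normP f : (lip_norm f <= 1)%E ->
  forall s t, `|f s - f t| <= Sigma_dist s t.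
Proof.
move=> f1 s t; have [->|/eqP st] := eqVneq s t.
  by rewrite subrr normr0 sqrtr_ge0.
have d0 : 0 < Sigma_dist s t.
  rewrite lt_def sqrtr_ge0 andbT sqrtr_eq0 -ltNge.
  set a := enorm _; set b := enorm (_.2 - _).
  rewrite lt_def addr_ge0 ?sqr_ge0 // andbT paddr_eq0 ?sqr_ge0 // !sqrf_eq0.
  rewrite /a /b !enorm_eq0 !subr_eq0; apply: contra_notN st =>
    /andP[/eqP s1 /eqP s2].
  by apply: val_inj; apply: injective_projections.
rewrite -[leRHS]mul1r -ler_pdivrMr // -lee_fin; apply: le_trans f1.
by apply: ereal_sup_ubound; exists (s, t).
Qed.

Lemma sup_normP f : (sup_norm f <= 1)%E -> forall s, `|f s| <= 1.
Proof.
move=> f1 s; rewrite -lee_fin; apply: le_trans f1.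
by apply: ereal_sup_ubound; exists s.
Qed.

Lemma lip_measurable f : (forall s t, `|f s - f t| <= Sigma_dist s t) ->
  measurable_fun [set: Sigma_borel R n'] (f : Sigma_borel R n' -> R).
Proof.
move=> f1; apply: (@measurability _ _ (Sigma_borel R n') R setT f
  (@RGenOInfty.G R)) => //.
  exact: RGenOInfty.measurableE.
move=> _ [_ [t ->] <-]; rewrite setTI; apply: sub_sigma_algebra.
change (open [set s | f s \in `]t, +oo[]).
rewrite openE => s /=; rewrite in_itv /= andbT => fs.
(* Half the gap, because [Sigma_dist] is bounded by the sum of the displacements of the two
   components. *)
have e0 : 0 < (f s - t) / 2 by rewrite divr_gt0 // subr_gt0.
set e := (f s - t) / 2 in e0.
pose V : set (E * E) := [set q | enorm ((Sigma_val s).1 - q.1) < e /\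
                                 enorm ((Sigma_val s).2 - q.2) < e].
have nV : nbhs (Sigma_val s) V.
  exists ([set x | enorm ((Sigma_val s).1 - x) < e],
          [set x | enorm ((Sigma_val s).2 - x) < e]) => /=; last by case.
  by split; apply/nbhs_enormP; exists e.
have : nbhs s (@Sigma_val R n' @^-1` V) by exact: (@initial_continuous _ _
  set_val s).
apply: filterS => u [u1 u2] /=; rewrite in_itv /= andbT.
have := le_trans (f1 s u) (Sigma_dist_le s u).
have := ler_norm (f s - f u).
by move: u1 u2; rewrite /e; lra.
Qed.

End lipschitz_on_Sigma.

(** * The local Steiner formula *)

(** Moves the restriction from the domain into the measure, so that the image measure formula can be
    used on the whole space. *)
Lemma ge0_integral_mrestr d (X : measurableType d) (R : realType)
    (mu : {measure set X -> \bar R}) (D : set X) (mD : measurable D)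
    (f : X -> \bar R) : measurable_fun [set: X] f -> (forall x, 0 <= f x)%E ->
  (\int[mrestr mu mD]_(x in setT) f x = \int[mu]_(x in D) f x)%E.
Proof.
move=> mf f0; rewrite -(setUv D) ge0_integral_setU //.
- rewrite [X in (_ + X = _)%E]null_set_integral ?adde0 //.
  + by apply: eq_measure_integral => A mA AD; rewrite /= /mrestr setIidl.
  + exact: measurableC.
  + exact: measurable_funTS.
  + by rewrite /= /mrestr setICl measure0.
- exact: measurableC.
- by rewrite setUv.
- by apply/disj_setPS; rewrite setICr.
Qed.

Section steiner_formula.
Context {R : realType} {n' : nat}.
Local Notation n := n'.+1.
Local Notation E := 'rV[R]_n.
Local Notation T := (caratheodory_type (hausdorff_outer R n')).
Local Notation H := (hausdorff_outer R n' : {measure set T -> \bar R}).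

Definition shell (K : set E) (s t : R) : set T := [set x | s < dist_to K x
  <= t].

Variable K : set E.
Hypothesis cK : convex_body K.

Lemma measurable_shell s t : measurable (shell K s t).
Proof.
have mK u : measurable ([set x | u < dist_to K x] : set T).
  by apply: lipschitz_measurable_gt => x y; exact: dist_to_lipschitz.
rewrite (_ : shell K s t = [set x | s < dist_to K x] `\` [set x | t < dist_to K
  x]).
  exact: measurableD.
apply/seteqP; split=> x; rewrite /shell /=.
  by case/andP=> sx xt; split=> //; apply/negP; rewrite -leNgt.
by case=> sx /negP; rewrite -leNgt => xt; apply/andP.
Qed.

Lemma local_parallel_measureE rho (A : set (Sigma_borel R n')) : 0 < rho ->
  local_parallel_measure K rho A = hausdorff_measure (normal_pair K @^-1` A `&`
    shell K 0 rho).
Proof.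
move=> r0; rewrite /local_parallel_measure parallel_shellE ?ltW //.
congr hausdorff_measure; apply/seteqP; split=> x /=.
  case=> xK [s As sx]; split=> //; rewrite (_ : normal_pair K x = s) //.
  case/andP: xK => x0 _; apply: val_inj.
  by rewrite -[LHS]/(Sigma_val _) normal_pairE.
case=> Ax xK; split=> //; exists (normal_pair K x) => //.
by case/andP: xK => x0 _; rewrite normal_pairE.
Qed.

Variable Lambda : 'I_n -> {finite_measure set (Sigma_borel R n') -> \bar R}.
Hypothesis LambdaP : support_measures K Lambda.

(** By [support_measures] the image of the restricted Hausdorff measure and the weighted sum of the
    [Lambda i] agree on measurable sets, hence as integrators. *)
Lemma integral_shell (rho : R) (g : Sigma R n' -> R) : 0 < rho ->
  measurable_fun [set: Sigma_borel R n'] (g : Sigma_borel R n' -> R) ->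
  (forall s, 0 <= g s) ->
  (\int[H]_(x in shell K 0 rho) (g (normal_pair K x))%:E =
   \sum_(i < n) (rho ^+ (n - i) * kappa R (n - i))%:E *
     \int[Lambda i]_(s in setT) (g s)%:E)%E.
Proof.
move=> r0 mg g0; set D := shell K 0 rho.
have mD : measurable D := measurable_shell 0 rho.
have mphi := measurable_normal_pair cK.
have mgE : measurable_fun [set: Sigma_borel R n'] (fun s => (g s)%:E).
  exact/measurable_EFinP.
have c0 k : 0 <= rho ^+ (n - k) * kappa R (n - k).
  by rewrite mulr_ge0 ?kappa_ge0 ?exprn_ge0 ?ltW.
(* [msum] takes a sequence indexed by nat, so [inord] extends the family; only indices below n are
   summed. *)
pose m_ (k : nat) : {measure set (Sigma_borel R n') -> \bar R} :=
  mscale (NngNum (c0 k)) (Lambda (inord k)).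
transitivity (\int[msum m_ n]_(s in setT) (g s)%:E)%E; last first.
  rewrite ge0_integral_measure_sum //; last by move=> s _; rewrite lee_fin.
  apply: eq_bigr => i _; rewrite ge0_integral_mscale //=; last first.
    by move=> s _; rewrite lee_fin.
  by rewrite inord_val.
have gphi := ge0_integral_pushforward mphi (mrestr H mD) measurableT mgE
  (fun s _ => g0 s).
transitivity (\int[mrestr H mD]_(x in setT) (g (normal_pair K x))%:E)%E.
  have mgphi : measurable_fun [set: T] (fun x => (g (normal_pair K x))%:E).
    exact: (measurableT_comp mgE mphi).
  by apply: esym; apply: (ge0_integral_mrestr H mD mgphi) => x; exact: g0.
symmetry; apply: eq_trans gphi; apply: eq_measure_integral => A mA _.
rewrite /pushforward /mrestr /= /msum /= -[RHS]/(hausdorff_measure _).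
rewrite -local_parallel_measureE // LambdaP //.
by apply: eq_bigr => i _; rewrite /m_ /= /mscale /= inord_val.
Qed.

(** The Steiner polynomial without its constant term: the volume of K_rho minus that of K. *)
Definition parallel_volume (rho : R) : R :=
  \sum_(i < n) rho ^+ (n - i) * kappa R (n - i) * fine (Lambda i setT).

Lemma hausdorff_shell rho : 0 < rho ->
  hausdorff_measure (shell K 0 rho) = (parallel_volume rho)%:E.
Proof.
move=> r0; have := local_parallel_measureE setT r0.
rewrite preimage_setT setTI => <-; rewrite LambdaP // -sumEFin.
apply: eq_bigr => i _; rewrite [RHS]EFinM fineK //.
exact: fin_num_measure.
Qed.

End steiner_formula.

(** A crude mean value bound; b^j in place of b^(j-1), allowed by b >= 1, avoids a predecessor in
    the induction. *)
Lemma expr_sub_le (R : realDomainType) (b s t : R) (j : nat) :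
  0 <= s <= t -> t <= b -> 1 <= b -> t ^+ j - s ^+ j <= j%:R * b ^+ j * (t - s).
Proof.
move=> /andP[s0 st] tb b1; elim: j => [|j IHj].
  by rewrite !expr0 subrr !mul0r.
have t0 : 0 <= t := le_trans s0 st.
have bj : 0 <= b ^+ j by rewrite exprn_ge0 // (le_trans t0).
have -> : t ^+ j.+1 - s ^+ j.+1 = t * (t ^+ j - s ^+ j) + s ^+ j * (t - s).
  by rewrite !exprS; ring.
have -> : j.+1%:R * b ^+ j.+1 * (t - s) =
    b * (j%:R * b ^+ j * (t - s)) + b * b ^+ j * (t - s).
  by rewrite -natr1 exprS; ring.
apply: lerD.
  apply: le_trans (_ : t * (j%:R * b ^+ j * (t - s)) <= _);
    first exact: ler_wpM2l.
  by apply: ler_wpM2r => //; rewrite !mulr_ge0 // subr_ge0.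
apply: ler_wpM2r; first by rewrite subr_ge0.
apply: le_trans (_ : b ^+ j <= _); last by rewrite ler_peMl.
by apply: lerXn2r; rewrite ?nnegrE //; [exact: le_trans tb|exact: le_trans tb].
Qed.

(** On the common part the integrands are compared pointwise; on the rest of A the bound b is used.
    A and B will be shells of two bodies. *)
Lemma ge0_integral_near_le d (X : measurableType d) (R : realType)
    (mu : {measure set X -> \bar R}) (A B : set X) (h k : X -> R) (c b : R) :
  measurable A -> measurable B ->
  measurable_fun [set: X] h -> measurable_fun [set: X] k ->
  (forall x, 0 <= h x <= b) -> (forall x, 0 <= k x) -> 0 <= c ->
  (forall x, A x -> B x -> h x <= k x + c) ->
  (\int[mu]_(x in A) (h x)%:E <=
   \int[mu]_(x in B) (k x)%:E + c%:E * mu A + b%:E * mu (A `\` B))%E.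
Proof.
move=> mA mB mh mk hb k0 c0 hk.
have mAB : measurable (A `&` B) by exact: measurableI.
have mAD : measurable (A `\` B) by exact: measurableD.
have mhE D : measurable_fun D (fun x => (h x)%:E).
  by apply/measurable_funTS/measurable_EFinP.
have mkE D : measurable_fun D (fun x => (k x)%:E).
  by apply/measurable_funTS/measurable_EFinP.
have h0 x : (0 <= (h x)%:E)%E by rewrite lee_fin; case/andP: (hb x).
have k0' x : (0 <= (k x)%:E)%E by rewrite lee_fin.
have b0 : 0 <= b by case/andP: (hb point) => /le_trans; apply.
rewrite -{1}(setUIDK A B) ge0_integral_setU //; last first.
  by apply/disj_setPS; rewrite setDE setIACA setICr setI0.
apply: leeD.
  apply: (@le_trans _ _ (\int[mu]_(x in A `&` B) ((k x)%:E + c%:E))%E).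
    apply: ge0_le_integral => //.
      by apply: emeasurable_funD => //.
    by move=> x [Ax Bx]; rewrite -EFinD lee_fin hk.
  rewrite ge0_integralD // integral_cst //; apply: leeD.
    by apply: ge0_subset_integral => // x [].
  apply: lee_wpmul2l; first by rewrite lee_fin.
  by apply: le_measure; rewrite ?inE // => x [].
rewrite -integral_cst //; apply: ge0_le_integral => // x _.
by rewrite lee_fin; case/andP: (hb x).
Qed.

(** * Volume of thin shells *)

Section shells.
Context {R : realType} {n' : nat}.
Local Notation n := n'.+1.
Local Notation E := 'rV[R]_n.
Local Notation T := (caratheodory_type (hausdorff_outer R n')).
Local Notation H := (hausdorff_outer R n' : {measure set T -> \bar R}).

Variable K : set E.
Hypothesis cK : convex_body K.
Variable Lambda : 'I_n -> {finite_measure set (Sigma_borel R n') -> \bar R}.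
Hypothesis LambdaP : support_measures K Lambda.
Local Notation V := (parallel_volume Lambda).

Let mass_ge0 (i : 'I_n) : 0 <= kappa R (n - i) * fine (Lambda i setT).
Proof. by rewrite mulr_ge0 ?kappa_ge0 // fine_ge0. Qed.

Lemma mass_le (i : 'I_n) : kappa R (n - i) * fine (Lambda i setT) <= V 1.
Proof.
rewrite /parallel_volume (bigD1 i) //= expr1n mul1r lerDl.
by apply: sumr_ge0 => j _; rewrite expr1n mul1r.
Qed.

(** Each power has Lipschitz constant at most n 2^n on [0, 2], and the nonnegative coefficients add
    up to V 1. *)
Lemma parallel_volume_lipschitz s t : 0 <= s <= t -> t <= 2 ->
  V t - V s <= n%:R * 2 ^+ n * V 1 * (t - s).
Proof.
move=> st t2; rewrite /parallel_volume -sumrB mulrAC mulr_sumr.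
apply: ler_sum => i _; set m := kappa R (n - i); set l := fine _.
have -> : t ^+ (n - i) * m * l - s ^+ (n - i) * m * l =
    (t ^+ (n - i) - s ^+ (n - i)) * (m * l) by ring.
have -> : n%:R * 2 ^+ n * (t - s) * (1 ^+ (n - i) * m * l) =
    n%:R * 2 ^+ n * (t - s) * (m * l) by rewrite expr1n mul1r.
apply: ler_wpM2r; first exact: mass_ge0.
have /andP[s0 st'] := st.
apply: le_trans (expr_sub_le (n - i) st t2 _) _; first by rewrite ler1n.
apply: ler_wpM2r; first by rewrite subr_ge0.
by apply: ler_pM; rewrite ?exprn_ge0 ?ler_nat ?leq_subr //
  ler_weXn2l ?ler1n ?leq_subr.
Qed.

Lemma hausdorff_shellB s t : 0 < s <= t ->
  hausdorff_measure (shell K s t) = (V t - V s)%:E.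
Proof.
move=> /andP[s0 st]; have t0 := lt_le_trans s0 st.
have -> : shell K s t = shell K 0 t `\` shell K 0 s.
  apply/seteqP; split=> x; rewrite /shell /=.
    case/andP=> sx xt; split; first by rewrite xt (lt_trans s0 sx).
    by apply/negP; rewrite negb_and -!ltNge sx orbT.
  by case=> /andP[x0 xt] /negP; rewrite x0 /= -ltNge => sx; rewrite sx xt.
transitivity (H (shell K 0 t) - H (shell K 0 t `&` shell K 0 s))%E.
  apply: (@measureD _ T R H); [exact: measurable_shell|exact:
    measurable_shell|].
  by rewrite [X in (X < _)%E](hausdorff_shell cK LambdaP t0) ltry.
have -> : shell K 0 t `&` shell K 0 s = shell K 0 s.
  apply/setIidPr => x; rewrite /shell /= => /andP[-> xs] /=.
  exact: le_trans xs st.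
rewrite EFinB; congr (_ - _)%E; exact: hausdorff_shell.
Qed.

End shells.

(** * Comparison of two convex bodies *)

Section integrals_over_shells.
Context {R : realType} {n' : nat}.
Local Notation n := n'.+1.
Local Notation E := 'rV[R]_n.
Local Notation T := (caratheodory_type (hausdorff_outer R n')).
Local Notation H := (hausdorff_outer R n' : {measure set T -> \bar R}).
Implicit Types (K L : set E)
  (Lambda : 'I_n -> {finite_measure set (Sigma_borel R n') -> \bar R}).

Variable g : Sigma R n' -> R.
Hypothesis mg : measurable_fun [set: Sigma_borel R n'] (g : Sigma_borel R n' ->
  R).
Hypothesis g02 : forall s, 0 <= g s <= 2.

Let g0 s : 0 <= g s. Proof. by case/andP: (g02 s). Qed.

Lemma integral_fin_num (mu : {finite_measure set (Sigma_borel R n') ->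
  \bar R}) :
  (\int[mu]_(s in setT) (g s)%:E)%E \is a fin_num.
Proof.
rewrite ge0_fin_numE; last by apply: integral_ge0 => s _; rewrite lee_fin.
apply: (@le_lt_trans _ _ (\int[mu]_(s in setT) (cst 2%:E s))%E).
  apply: ge0_le_integral => //.
  - by move=> s _; rewrite lee_fin.
  - exact/measurable_EFinP.
  - by move=> s _; rewrite lee_fin; case/andP: (g02 s).
rewrite integral_cst // lte_mul_pinfty ?lee_fin //.
by rewrite -ge0_fin_numE // fin_num_measure.
Qed.

(** The integral over the shell between 1 and rho ([integral_shellB]); the -1 comes from subtracting
    the shell between 0 and 1. *)
Definition shell_sum Lambda (rho : R) : R :=
  \sum_(i < n) (rho ^+ (n - i) - 1) *
    (kappa R (n - i) * fine (\int[Lambda i]_(s in setT) (g s)%:E)%E).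

Lemma measurable_normal_pair_comp K : convex_body K ->
  measurable_fun [set: T] (fun x : T => g (normal_pair K x)).
Proof. by move=> cK; exact: (measurableT_comp mg (measurable_normal_pair cK)).
  Qed.

Lemma integral_shellB K Lambda (rho : R) : convex_body K ->
  support_measures K Lambda -> 1 <= rho ->
  (\int[H]_(x in shell K 1 rho) (g (normal_pair K x))%:E =
   (shell_sum Lambda rho)%:E)%E.
Proof.
move=> cK LambdaP r1; have r0 := lt_le_trans ltr01 r1.
have mgK := measurable_normal_pair_comp cK.
pose S (t : R) := \sum_(i < n) t ^+ (n - i) * kappa R (n - i) *
    fine (\int[Lambda i]_(s in setT) (g s)%:E)%E.
have intS t : 0 < t ->
    (\int[H]_(x in shell K 0 t) (g (normal_pair K x))%:E = (S t)%:E)%E.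
  move=> t0; rewrite (integral_shell cK LambdaP) // -sumEFin.
  by apply: eq_bigr => i _; rewrite [RHS]EFinM fineK // integral_fin_num.
have shellU : shell K 0 rho = shell K 0 1 `|` shell K 1 rho.
  apply/seteqP; split=> x; rewrite /shell /=.
    by case/andP=> x0 xr; case: (leP (dist_to K x) 1) => x1; [left|right];
      rewrite ?x0.
  case=> /andP[x0 xr]; first by rewrite x0 (le_trans xr).
  by rewrite xr (lt_trans ltr01 x0).
have := intS _ r0; rewrite shellU ge0_integral_setU; first last.
- apply/disj_setPS => x; rewrite /shell /= => -[/andP[_ x1] /andP[x1' _]].
  by move: x1; rewrite leNgt x1'.
- by move=> x _; rewrite lee_fin.
- exact/measurable_funTS/measurable_EFinP.
- exact: measurable_shell.
- exact: measurable_shell.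
rewrite (intS _ ltr01) => /(congr1 (fun y => y - (S 1)%:E)%E).
rewrite addeAC subee // add0e => ->; rewrite -EFinB; congr EFin.
rewrite /S /shell_sum -sumrB; apply: eq_bigr => i _.
by rewrite expr1n; ring.
Qed.

Hypothesis g1 : forall s t, `|g s - g t| <= Sigma_dist s t.

Section two_bodies.
Variables (K L : set E) (d : R).
Hypotheses (cK : convex_body K) (cL : convex_body L) (d01 : 0 <= d < 1).
Hypothesis KL : forall x, K x -> dist_to L x <= d.
Hypothesis LK : forall x, L x -> dist_to K x <= d.

(** Each component moves by at most 2 sqrt d: the points because d_K + d_L <= 4 in [proj_stability],
    the directions because x - p and x - q have norm at least 1 and differ by q - p. *)
Lemma normal_pair_stability (x : E) :
  1 <= dist_to K x <= 2 -> 1 <= dist_to L x <= 2 ->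
  Sigma_dist (normal_pair K x) (normal_pair L x) <= 4 * Num.sqrt d.
Proof.
move=> /andP[K1 K2] /andP[L1 L2]; have /andP[d0 _] := d01.
apply: le_trans (Sigma_dist_le _ _) _.
rewrite !normal_pairE ?(lt_le_trans ltr01) //=.
have pq : enorm (proj K x - proj L x) <= 2 * Num.sqrt d.
  rewrite ler_enorm ?mulr_ge0 ?sqrtr_ge0 // -sqr_enorm exprMn (sqr_sqrtr d0) //.
  apply: le_trans (proj_stability cK cL KL LK x) _; apply: ler_wpM2r => //.
  by apply: le_trans (lerD K2 L2) _; rewrite -natrD -natrX.
have uv : enorm (normal_dir K x - normal_dir L x) <= 2 * Num.sqrt d.
  rewrite !normal_dirE !dist_toE in K1 L1 *.
  apply: le_trans (enorm_normalize_le K1 L1) _; apply: le_trans pq.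
  by rewrite [leRHS]enormB opprB addrC subrKA.
by apply: le_trans (lerD pq uv) _; rewrite -mulrDl -natrD.
Qed.

Lemma shell_stability (rho : R) :
  shell K 1 rho `\` shell L 1 rho `<=` shell K 1 (1 + d) `|` shell K (rho - d)
    rho.
Proof.
move=> x; rewrite /shell /= => -[/andP[K1 Kr] /negP].
have := dist_to_stability cK cL KL LK x.
move: K1 Kr; move: (dist_to K x) (dist_to L x) => a b K1 Kr.
rewrite ler_norml negb_and -leNgt -ltNge => ab /orP[b1|br]; [left|right].
  by apply/andP; split=> //; lra.
by apply/andP; split=> //; lra.
Qed.

Variables (LambdaK LambdaL : 'I_n -> {finite_measure set (Sigma_borel R n') ->
  \bar R}).
Hypotheses (LambdaKP : support_measures K LambdaK)
  (LambdaLP : support_measures L LambdaL).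
Variable M : R.
Hypotheses (KM : forall rho, rho <= 2 -> (hausdorff_measure (shell K 0 rho)
  <= M%:E)%E).

(** One-sided, since K and L can be exchanged. The Lipschitz error 4 sqrt d on a set of measure at
    most M gives the first 4; the bound 2 of g on two layers of measure at most n 2^n M d gives the
    second, with d <= sqrt d. *)
Lemma shell_sum_le (rho : R) : 1 <= rho <= 2 ->
  shell_sum LambdaK rho <=
  shell_sum LambdaL rho + (4 + 4 * (n%:R * 2 ^+ n)) * M * Num.sqrt d.
Proof.
move=> /andP[r1 r2]; have /andP[d0 d1] := d01.
have V1M : parallel_volume LambdaK 1 <= M.
  by rewrite -lee_fin -(hausdorff_shell cK LambdaKP ltr01) KM // ler1n.
have M0 : 0 <= M.
  by rewrite -lee_fin; apply: le_trans (KM r2); exact: outer_measure_ge0.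
have dsq : d <= Num.sqrt d.
  by rewrite -{1}(sqr_sqrtr d0) expr2 ler_piMl ?sqrtr_ge0 //
    -sqrtr1 ler_sqrt // ltW.
(* Applied at s = 1 and s = rho - d; d < 1 ensures 1 + d <= 2 and rho - d > 0. *)
have Vd s : 0 < s -> s + d <= 2 ->
    (hausdorff_measure (shell K s (s + d)) <= (n%:R * 2 ^+ n * M * d)%:E)%E.
  move=> s0 sd2; rewrite (hausdorff_shellB cK LambdaKP) ?s0 ?lerDl // lee_fin.
  apply: le_trans (parallel_volume_lipschitz LambdaK _ sd2) _.
    by rewrite ltW // lerDl.
  rewrite [X in _ * X](_ : _ = d); last by rewrite addrC addKr.
  by apply: ler_wpM2r => //; apply: ler_wpM2l V1M; rewrite mulr_ge0 ?exprn_ge0.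
rewrite -lee_fin -(integral_shellB cK LambdaKP r1) EFinD -(integral_shellB cL
  LambdaLP r1).
apply: le_trans (@ge0_integral_near_le _ T R H (shell K 1 rho) (shell L 1 rho)
  (fun x => g (normal_pair K x)) (fun x => g (normal_pair L x)) (4 * Num.sqrt
    d) 2
  (measurable_shell cK _ _) (measurable_shell cL _ _)
  (measurable_normal_pair_comp cK) (measurable_normal_pair_comp cL) _ _ _ _) _.
- by move=> x; exact: g02.
- by move=> x; exact: g0.
- by rewrite mulr_ge0 ?sqrtr_ge0.
- move=> x /andP[x1 xr] /andP[y1 yr].
  have := le_trans (g1 (normal_pair K x) (normal_pair L x))
    (normal_pair_stability _ _).
  rewrite (ltW x1) (ltW y1) (le_trans xr r2) (le_trans yr r2) => /(_ isT isT).
  by rewrite ler_norml lerBlDl => /andP[_].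
rewrite -addeA leeD2l //.
have HK : (hausdorff_measure (shell K 1 rho) <= M%:E)%E.
  apply: le_trans (KM r2); apply: le_outer_measure => x /andP[x1 xr].
  by apply/andP; split=> //; exact: lt_trans x1.
have HD : (hausdorff_measure (shell K 1 rho `\` shell L 1 rho) <=
    (2 * (n%:R * 2 ^+ n * M * d))%:E)%E.
  apply: le_trans (le_outer_measure (hausdorff_outer R n') _ _
    (@shell_stability rho)) _.
  apply: le_trans (outer_measureU2 (hausdorff_outer R n') _ _) _.
  rewrite mulr_natl mulr2n EFinD; apply: leeD.
    by apply: Vd => //; lra.
  by rewrite -{2}[rho](subrK d); apply: Vd; lra.
apply: (@le_trans _ _ ((4 * Num.sqrt d)%:E * M%:E +
    2%:E * (2 * (n%:R * 2 ^+ n * M * d))%:E)%E).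
  by apply: leeD; apply: lee_wpmul2l; rewrite ?lee_fin ?mulr_ge0 ?sqrtr_ge0.
rewrite -!EFinM -EFinD lee_fin.
have nM : 0 <= n%:R * 2 ^+ n * M by rewrite !mulr_ge0 ?exprn_ge0.
have := ler_wpM2l nM dsq; move: (n%:R * 2 ^+ n) (Num.sqrt d) => u v.
by rewrite -![u * M * _]mulrA; nra.
Qed.

End two_bodies.
End integrals_over_shells.

(** The sum is a polynomial of degree at most N in rho whose constant coefficient is minus the sum
    of the D i. Its values at N + 1 distinct nodes determine all coefficients, and Q is the entry
    sum of the absolute inverse Vandermonde matrix. *)
Lemma polynomial_coef_bound (R : realFieldType) (N : nat) :
  exists2 Q : R, 0 <= Q & forall (D : 'I_N -> R) (e : R),
    (forall rho, 1 <= rho <= 2 ->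
      `|\sum_(i < N) (rho ^+ (N - i) - 1) * D i| <= e) ->
    forall i, `|D i| <= Q * e.
Proof.
pose a : 'rV[R]_N.+1 := \row_j (1 + j%:R / N.+1%:R).
pose V := Vandermonde N.+1 a.
have Vunit : V \in unitmx.
  rewrite unitmxE det_Vandermonde unitfE; apply/prodf_neq0 => i _.
  apply/prodf_neq0 => j ij; rewrite !mxE subr_eq0 eq_sym; apply: contraTneq ij.
  have N0 : N.+1%:R^-1 != 0 :> R by rewrite invr_eq0 pnatr_eq0.
  by move=> /addrI/(mulIf N0)/eqP; rewrite eqr_nat => /eqP ->; rewrite ltnn.
pose Q := \sum_j \sum_k `|invmx V j k|.
exists Q; first by apply: sumr_ge0 => j _; exact: sumr_ge0.
move=> D e De i.
have a12 j : 1 <= a 0 j <= 2.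
  have j1 : j%:R / N.+1%:R <= 1 :> R by rewrite ler_pdivrMr //
    mul1r ler_nat ltnW.
  by rewrite mxE lerDl divr_ge0 //= (_ : 2 = 1 + 1 :> R) // lerD2l.
have e0 : 0 <= e by apply: le_trans (De 1 _); rewrite ?normr_ge0 // lexx ler1n.
(* Row index k stands for the degree; D i has degree N - i, hence [rev_ord]. *)
pose c : 'rV[R]_N.+1 :=
  \row_k (if unlift ord0 k is Some j then D (rev_ord j) else - \sum_j D j).
have cV j : `|(c *m V) 0 j| <= e.
  rewrite mxE big_ord_recl !mxE unlift_none expr0 mulr1.
  have -> : \sum_(k < N) c 0 (lift ord0 k) * V (lift ord0 k) j =
      \sum_(k < N) D k * a 0 j ^+ (N - k).
    rewrite [RHS](reindex_inj rev_ord_inj) /=; apply: eq_bigr => k _.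
    by rewrite !mxE liftK subnA ?subnn ?add0n //.
  rewrite addrC -sumrB.
  rewrite (eq_bigr (fun k : 'I_N => (a 0 j ^+ (N - k) - 1) * D k));
    first exact: De.
  by move=> k _; ring.
have cE : c = c *m V *m invmx V by rewrite mulmxK.
have -> : D i = c 0 (lift ord0 (rev_ord i)) by rewrite mxE liftK rev_ordK.
rewrite cE mxE; set k := lift _ _.
apply: le_trans (ler_norm_sum _ _ _) _; rewrite mulr_suml;
  apply: ler_sum => j _.
rewrite normrM mulrC; apply: ler_pM => //.
by rewrite (bigD1 k) //= lerDl sumr_ge0.
Qed.

(** * Stability of integrals against support measures *)

Section support_measure_stability.
Context {R : realType} {n' : nat}.
Local Notation n := n'.+1.
Local Notation E := 'rV[R]_n.
Variables (K L : set E) (LambdaK LambdaL : 'I_n ->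
  {finite_measure set (Sigma_borel R n') -> \bar R}).
Variables (c : E) (r : R).
Hypotheses (cK : convex_body K) (cL : convex_body L).
Hypotheses (LambdaKP : support_measures K LambdaK)
  (LambdaLP : support_measures L LambdaL).
Hypotheses (Kr : parallel_body K 2 `<=` eball c r) (Lr : parallel_body L 2 `<=`
  eball c r).
Local Notation M := (ball_bound n' r).
Local Notation d := (hausdorff_distance K L).

Lemma hausdorff_shell_le (A : set E) (rho : R) : convex_body A ->
  parallel_body A 2 `<=` eball c r -> rho <= 2 ->
  (hausdorff_measure (shell A 0 rho) <= M%:E)%E.
Proof.
move=> cA Ar r2; apply: le_trans (hausdorff_measure_eball c r).
apply: (le_outer_measure (hausdorff_outer R n')) => x /andP[_ xr]; apply: Ar.
by rewrite parallel_bodyE //=; exact: le_trans r2.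
Qed.

Lemma mass_bound (A : set E) Lambda (i : 'I_n) : convex_body A ->
  support_measures A Lambda -> parallel_body A 2 `<=` eball c r ->
  fine (Lambda i setT) <= M / kappa R (n - i).
Proof.
move=> cA LambdaP Ar; rewrite ler_pdivlMr ?kappa_gt0 // mulrC.
apply: le_trans (mass_le Lambda i) _.
by rewrite -lee_fin -(hausdorff_shell cA LambdaP) // hausdorff_shell_le //
  ler1n.
Qed.

Lemma sub_parallel_body (A : set E) : convex_body A -> A `<=` parallel_body A 2.
Proof.
move=> cA x Ax; rewrite parallel_bodyE //=.
by have /eqP -> : dist_to A x == 0 by rewrite dist_to_eq0 // mem_set.
Qed.

Variable Q : R.
Hypothesis Q0 : 0 <= Q.
Hypothesis QP : forall (D : 'I_n -> R) (e : R),
    (forall rho, 1 <= rho <= 2 ->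
      `|\sum_(i < n) (rho ^+ (n - i) - 1) * D i| <= e) ->
    forall i, `|D i| <= Q * e.

(** The term with Q serves d < 1, the summand 2 serves d >= 1; division by kappa turns a polynomial
    coefficient into an integral. *)
Definition stability_const (i : 'I_n) : R :=
  (Q * (4 + 4 * (n%:R * 2 ^+ n)) + 2) * M / kappa R (n - i).

Lemma lip_integral_stability (g : Sigma R n' -> R) (i : 'I_n) :
  (forall s, 0 <= g s <= 2) -> (forall s t, `|g s - g t| <= Sigma_dist s t) ->
  `|fine (\int[LambdaK i]_(s in setT) (g s)%:E)%E -
    fine (\int[LambdaL i]_(s in setT) (g s)%:E)%E|
      <= stability_const i * Num.sqrt d.
Proof.
move=> g02 g1; have mg := lip_measurable g1.
have [d0 KL LK] := hausdorff_distanceP cK cL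
  (subset_trans (sub_parallel_body cK) Kr) (subset_trans (sub_parallel_body cL)
    Lr).
have M0 : 0 <= M := ball_bound_ge0 _ _.
have kpos := kappa_gt0 (R := R) (n - i).
set J := Q * (4 + 4 * (n%:R * 2 ^+ n)).
have J0 : 0 <= J by rewrite mulr_ge0 ?addr_ge0 ?mulr_ge0 ?exprn_ge0.
have sc : stability_const i = (J + 2) * (M / kappa R (n - i)) by rewrite mulrA.
have Mk0 : 0 <= M / kappa R (n - i) by rewrite divr_ge0 // ltW.
set GK := fine _; set GL := fine _.
(* For d >= 1 both integrals lie in [0, 2 M / kappa] and sqrt d >= 1, so no comparison of shells is
   required. *)
have [d1|d1] := ltP d 1.
  have sumB rho : 1 <= rho <= 2 ->
      `|\sum_(j < n) (rho ^+ (n - j) - 1) * (kappa R (n - j) *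
        (fine (\int[LambdaK j]_(s in setT) (g s)%:E)%E -
         fine (\int[LambdaL j]_(s in setT) (g s)%:E)%E))| <=
      (4 + 4 * (n%:R * 2 ^+ n)) * M * Num.sqrt d.
    move=> rho12.
    have d01 : 0 <= d < 1 by rewrite d0.
    have hK := shell_sum_le mg g02 g1 cK cL d01 KL LK LambdaKP LambdaLP
      (fun t => @hausdorff_shell_le K t cK Kr) rho12.
    have hL := shell_sum_le mg g02 g1 cL cK d01 LK KL LambdaLP LambdaKP
      (fun t => @hausdorff_shell_le L t cL Lr) rho12.
    rewrite (_ : \sum_(j < n) _ = shell_sum g LambdaK rho - shell_sum g LambdaL
      rho).
      by rewrite ler_norml lerBlDl hK andbT lerBrDl lerBlDr hL.
    by rewrite /shell_sum -sumrB; apply: eq_bigr => j _; ring.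
  have := QP sumB i; rewrite normrM ger0_norm ?(ltW kpos) // -/GK -/GL.
  rewrite mulrC -ler_pdivlMr // => /le_trans; apply.
  rewrite (_ : Q * _ / _ = J * (M / kappa R (n - i) * Num.sqrt d)); last first.
    by rewrite /J; ring.
  rewrite sc -[leRHS]mulrA; apply: ler_wpM2r;
    first by rewrite mulr_ge0 ?sqrtr_ge0.
  by rewrite lerDl.
have mass (A : set E) Lambda : convex_body A -> support_measures A Lambda ->
    parallel_body A 2 `<=` eball c r ->
    0 <= fine (\int[Lambda i]_(s in setT) (g s)%:E)%E
      <= 2 * (M / kappa R (n - i)).
  move=> cA LambdaP Ar; apply/andP; split.
    by apply: fine_ge0; apply: integral_ge0 => s _; rewrite lee_fin;
      case/andP: (g02 s).
  apply: le_trans (ler_wpM2l _ (mass_bound i cA LambdaP Ar)) => //.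
  rewrite -lee_fin fineK ?integral_fin_num // EFinM fineK ?fin_num_measure //.
  rewrite -(integral_cst (Lambda i) measurableT).
  apply: (ge0_le_integral _ measurableT).
  - by move=> s _; rewrite lee_fin; case/andP: (g02 s).
  - exact/measurable_EFinP.
  - exact: measurable_cst.
  - by move=> s _; rewrite lee_fin; case/andP: (g02 s).
have := mass K _ cK LambdaKP Kr; have := mass L _ cL LambdaLP Lr.
rewrite -/GK -/GL => /andP[l0 l1] /andP[k0 k1].
have s1 : 1 <= Num.sqrt d by rewrite -sqrtr1 ler_sqrt // (lt_le_trans ltr01).
apply: (@le_trans _ _ (2 * (M / kappa R (n - i)))).
  move: l0 l1 k0 k1; move: (2 * _) GK GL => m x y l0 l1 k0 k1.
  by rewrite ler_norml; apply/andP; split; lra.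
apply: (@le_trans _ _ (stability_const i)).
  by rewrite sc; apply: ler_wpM2r => //; rewrite lerDr.
by rewrite ler_peMr // sc mulr_ge0 // addr_ge0.
Qed.

(** Reduces a signed test function to f + 1 and 1, both with values in [0, 2] and as Lipschitz as f;
    finiteness of the integrals justifies [fine]. *)
Lemma integral_shift (mu : {finite_measure set (Sigma_borel R n') -> \bar R})
    (f : Sigma R n' -> R) : (forall s, `|f s| <= 1) ->
  measurable_fun [set: Sigma_borel R n'] (f : Sigma_borel R n' -> R) ->
  (\int[mu]_(s in setT) (f s)%:E)%E =
  (fine (\int[mu]_(s in setT) (f s + 1)%:E)%E - fine (\int[mu]_(s in setT)
    1%:E)%E)%:E.
Proof.
move=> f1 mf.
have f02 s : 0 <= f s + 1 <= 2.
  by have := f1 s; rewrite ler_norml -lerBlDr sub0r lerD2r => /andP[-> ?].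
have mf1 : measurable_fun [set: Sigma_borel R n'] (fun s : Sigma_borel R n' =>
  f s + 1).
  exact: measurable_funD.
have fin := integral_fin_num mf1 f02 mu.
have fin1 : (\int[mu]_(s in setT) 1%:E)%E \is a fin_num.
  by apply: (@integral_fin_num _ _ (fun=> 1)) => // s; rewrite ler01 ler1n.
rewrite EFinB !fineK //.
have intg (h : Sigma R n' -> R) : measurable_fun [set: Sigma_borel R n'] (h :
  Sigma_borel R n' -> R) ->
    (forall s, 0 <= h s) -> (\int[mu]_(s in setT) (h s)%:E)%E \is a fin_num ->
    mu.-integrable setT (fun s => (h s)%:E).
  move=> mh h0 hfin; apply/integrableP; split; first exact/measurable_EFinP.
  under eq_integral => s _ do rewrite gee0_abs ?lee_fin //.
  by rewrite ltey_eq hfin.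
have intf1 := intg _ mf1 (fun s => proj1 (andP (f02 s))) fin.
have int1 := intg (fun=> 1) (measurable_cst _) (fun=> ler01) fin1.
rewrite -(integralB measurableT intf1 int1).
by apply: eq_integral => s _; rewrite -EFinB addrK.
Qed.

End support_measure_stability.

Theorem theorem2 (R : realType) (n : nat) :
  exists C : R -> R,
    forall (K L : set 'rV[R]_n.+1)
      (LambdaK LambdaL :
         'I_n.+1 -> {finite_measure set (Sigma_borel R n) -> \bar R})
      (c : 'rV[R]_n.+1) (r : R),
      convex_body K -> convex_body L ->
      support_measures K LambdaK -> support_measures L LambdaL ->
      parallel_body K 2 `<=` eball c r -> parallel_body L 2 `<=` eball c r ->
      forall i : 'I_n.+1,
        (bL_distance (LambdaK i) (LambdaL i) <=
         (C r * Num.sqrt (hausdorff_distance K L))%:E)%E.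
Proof.
have [Q Q0 QP] := polynomial_coef_bound R n.+1.
(* Summing over all indices makes the constant independent of i; the factor 2 accounts for f + 1 and
   for the constant 1. *)
exists (fun r => \sum_(j < n.+1) 2 * stability_const r Q j).
move=> K L LambdaK LambdaL c r cK cL LambdaKP LambdaLP Kr Lr i.
apply: ge_ereal_sup => _ [f [/lip_normP flip /sup_normP fsup] <-].
have mf := lip_measurable flip.
rewrite (integral_shift (LambdaK i) fsup mf) (integral_shift (LambdaL i) fsup
  mf).
rewrite -EFinB abse_EFin lee_fin.
have stab := lip_integral_stability cK cL LambdaKP LambdaLP Kr Lr Q0 QP.
have hf : `|fine (\int[LambdaK i]_(s in setT) (f s + 1)%:E)%E -
    fine (\int[LambdaL i]_(s in setT) (f s + 1)%:E)%E| <=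
    stability_const r Q i * Num.sqrt (hausdorff_distance K L).
  apply: (stab (fun s => f s + 1)) => [s|s t].
    by have := fsup s; rewrite ler_norml -lerBlDr sub0r lerD2r => /andP[-> ?].
  by rewrite /= opprD addrACA subrr addr0.
have h1 : `|fine (\int[LambdaK i]_(s in setT) 1%:E)%E -
    fine (\int[LambdaL i]_(s in setT) 1%:E)%E| <=
    stability_const r Q i * Num.sqrt (hausdorff_distance K L).
  apply: (stab (fun=> 1)) => [s|s t]; first by rewrite ler01 ler1n.
  by rewrite subrr normr0 sqrtr_ge0.
apply: (@le_trans _ _ (2 * stability_const r Q i * Num.sqrt (hausdorff_distance
  K L))).
  rewrite opprD opprK addrACA -mulrA mulr_natl mulr2n.
  apply: le_trans (ler_normD _ _) _; apply: lerD; first exact: hf.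
  by rewrite addrC distrC; exact: h1.
apply: ler_wpM2r; first exact: sqrtr_ge0.
rewrite (bigD1 i) //= lerDl; apply: sumr_ge0 => j _.
rewrite !mulr_ge0 ?invr_ge0 ?kappa_ge0 ?ball_bound_ge0 ?addr_ge0 ?mulr_ge0
  ?addr_ge0 //.
Qed.
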